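(* Let $\mathbb F$ be an algebraically closed field, let $A(s)\in\mathbb F[s]^{p\times q}$ be a matrix pencil and let $P(s)\in\mathbb F[s]^{p\times q}$ be a matrix pencil of normal rank one. For every $\lambda\in\overline{\mathbb F}=\mathbb F\cup\{\infty\}$ the following hold (writing $\Delta_i=w_i(\lambda,A(s)+P(s))-w_i(\lambda,A(s))$): \begin{enumerate} \item[(i)] If both $A(s)$ and $A(s)+P(s)$ are regular, then $-1\le \Delta_i\le 1$ for all $i\ge 1$. \item[(ii)] If $A(s)$ is regular but $A(s)+P(s)$ is singular, then there exists an integer $a\ge1$ such that $-1\le\Delta_i\le 1$ for $1\le i\le a$ and $-2\le \Delta_i\le 0$ for $i\ge a+1$. \item[(iii)] If $A(s)$ is singular and $A(s)+P(s)$ is regular, then there exists an integer $a\ge 1$ such that $-1\le \Delta_i\le 1$ for $1\le i\le a$ and $0\le\Delta_i\le 2$ for $i\ge a+1$. \item[(iv)] If both $A(s)$ and $A(s)+P(s)$ are singular: \begin{itemize} \item If $\operatorname{rank}A(s)=\operatorname{rank}(A(s)+P(s))$ and $A(s)$ and $A(s)+P(s)$ have the same column minimal indices, then $-1\le\Delta_i\le 1$ for all $i\ge1$. \item If $\operatorname{rank}A(s)=\operatorname{rank}(A(s)+P(s))$ and $A(s)$ and $A(s)+P(s)$ have different column minimal indices, then there exist integers $b>a\ge1$ such that $-1\le\Delta_i\le1$ for $1\le i\le a$, $-(a+1)\le\Delta_i\le a+1$ for $a+1\le i\le b$, and $-b\le\Delta_i\le b$ for $i\ge b+1$. \item If $\operatorname{rank}A(s)<\operatorname{rank}(A(s)+P(s))$,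 then there exists an integer $a\ge1$ such that $-1\le\Delta_i\le 1$ for $1\le i\le a$ and $0\le \Delta_i\le a+1$ for $i\ge a+1$. \item If $\operatorname{rank}A(s)>\operatorname{rank}(A(s)+P(s))$, then there exists an integer $a\ge1$ such that $-1\le\Delta_i\le 1$ for $1\le i\le a$ and $-(a+1)\le \Delta_i\le 0$ for $i\ge a+1$. \end{itemize} \end{enumerate}
   Context: A matrix pencil is $A(s)=A_0+sA_1$ with $A_0,A_1\in\mathbb F^{p\times q}$. Its (normal) rank $\operatorname{rank}A(s)$ is its rank as a matrix over the field of rational functions $\mathbb F(s)$. It is regular if $p=q=\operatorname{rank}A(s)$, and singular otherwise. The column minimal indices of $A(s)$ are the sizes $k$ of the blocks $L_k(s)\in\mathbb F[s]^{k\times(k+1)}$ (with $s$ on the diagonal and $1$ on the superdiagonal), counted with multiplicity and including $q-\operatorname{rank}A(s)$ in total (zero indices corresponding to zero columns), in the Kronecker canonical form of $A(s)$ under strict equivalence $A(s)\mapsto PA(s)Q$ with $P,Q$ constant invertible matrices. We set $A(\infty):=A_1$. For $\lambda\in\overline{\mathbb F}$, an ordered set $(x_k,\dots,x_0)$ of vectors in $\mathbb F^q$ is a (right) Jordan chain of $A(s)$ at $\lambda$ of length $k+1$ if $x_0\ne0$ and: for $\lambda\in\mathbb F$, $A(\lambda)x_0=0$ and $A(\lambda)x_i=-A_1x_{i-1}$ for $1\le i\le k$; for $\lambda=\infty$, $A_1x_0=0$ and $A_1x_i=-A_0x_{i-1}$ for $1\le i\le k$. Let $\mathcal L^\ell_\lambda(A(s))$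 be the subspace spanned by all vectors of all Jordan chains of $A(s)$ at $\lambda$ of length at most $\ell$ ($\ell\ge1$), with $\mathcal L^0_\lambda(A(s))=\{0\}$ (and all these are $\{0\}$ if there is no Jordan chain at $\lambda$). The generalized Weyr characteristic is $w_i(\lambda,A(s))=\dim\big(\mathcal L^i_\lambda(A(s))/\mathcal L^{i-1}_\lambda(A(s))\big)$, $i\ge1$. *)

(* Defs.v *)
From HB Require Import structures.
From mathcomp Require Import all_boot all_order all_algebra.
From mathcomp Require Import boolp.
Set Implicit Arguments. Unset Strict Implicit. Unset Printing Implicit Defensive.
Import Order.TTheory GRing.Theory Num.Theory.
Local Open Scope ring_scope.

Section Pencils.
Variable F : fieldType.

Definition pencil_poly p q (A0 A1 : 'M[F]_(p, q)) : 'M[{poly F}]_(p, q) :=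
  \matrix_(i, j) ((A0 i j)%:P + (A1 i j)%:P * 'X).

Definition nrank p q (A0 A1 : 'M[F]_(p, q)) : nat :=
  \rank (map_mx (@FracField.tofrac {poly F}) (pencil_poly A0 A1)).

Definition regular p q (A0 A1 : 'M[F]_(p, q)) : Prop :=
  p = q /\ nrank A0 A1 = q.

(* KL k   : L_k      (k x (k+1)), s on the diagonal, 1 on the superdiagonal
   KLt k  : L_k^T    ((k+1) x k)
   KJ l k : Jordan block (s - l) I_k + N_k, eigenvalue l, k >= 1
   KN k   : infinite Jordan block I_k + s N_k, k >= 1
   (N_k = nilpotent matrix with ones on the superdiagonal) *)
Inductive kblock := KL of nat | KLt of nat | KJ of F & nat | KN of nat.

Definition rdim (b : kblock) : nat :=
  match b with KL k => k | KLt k => k.+1 | KJ _ k => k | KN k => k end.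
Definition cdim (b : kblock) : nat :=
  match b with KL k => k.+1 | KLt k => k | KJ _ k => k | KN k => k end.

(* constant coefficient (B0) and s-coefficient (B1) of a block, 0-indexed *)
Definition blk0 (b : kblock) (i j : nat) : F :=
  match b with
  | KL _ => (j == i.+1)%:R
  | KLt _ => (i == j.+1)%:R
  | KJ l _ => - ((i == j)%:R * l) + (j == i.+1)%:R
  | KN _ => (i == j)%:R
  end.
Definition blk1 (b : kblock) (i j : nat) : F :=
  match b with
  | KL _ => (i == j)%:R
  | KLt _ => (i == j)%:R
  | KJ _ _ => (i == j)%:R
  | KN _ => (j == i.+1)%:R
  end.

Definition kblock_ok (b : kblock) : bool :=
  match b with KJ _ k => 0 < k | KN k => 0 < k | _ => true end%N.

Definition kcf_entry (c : bool) (bs : seq kblock) (i j : nat) : F :=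
  \sum_(t < size bs)
    let b := nth (KN 0) bs t in
    let ro := sumn (map rdim (take t bs)) in
    let co := sumn (map cdim (take t bs)) in
    if ((ro <= i < ro + rdim b) && (co <= j < co + cdim b))%N
    then (if c then blk1 b (i - ro) (j - co) else blk0 b (i - ro) (j - co))
    else 0.

Definition is_kcf p q (A0 A1 : 'M[F]_(p, q)) (bs : seq kblock) : Prop :=
  [/\ all kblock_ok bs, sumn (map rdim bs) = p, sumn (map cdim bs) = q &
      exists (P : 'M[F]_p) (Q : 'M[F]_q),
        [/\ P \in unitmx, Q \in unitmx,
            P *m A0 *m Q = \matrix_(i, j) kcf_entry false bs i j &
            P *m A1 *m Q = \matrix_(i, j) kcf_entry true bs i j]].

Definition col_indices (bs : seq kblock) : seq nat :=
  pmap (fun b => if b is KL k then Some k else None) bs.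

Definition col_min_indices p q (A0 A1 : 'M[F]_(p, q)) (e : seq nat) : Prop :=
  exists bs, is_kcf A0 A1 bs /\ perm_eq e (col_indices bs).

Definition same_col_min_indices p q (A0 A1 B0 B1 : 'M[F]_(p, q)) : Prop :=
  exists e, col_min_indices A0 A1 e /\ col_min_indices B0 B1 e.

(* ---------- Jordan chains; lam = Some l (finite) or None (infinity) *)
(* (x k, ..., x 0) is a Jordan chain of length k+1 *)
Definition jordan_chain p q (A0 A1 : 'M[F]_(p, q)) (lam : option F)
    (k : nat) (x : nat -> 'cV[F]_q) : Prop :=
  x 0%N != 0 /\
  match lam with
  | Some l => (A0 + l *: A1) *m x 0%N = 0 /\
      forall i, (1 <= i <= k)%N -> (A0 + l *: A1) *m x i = - (A1 *m x i.-1)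
  | None => A1 *m x 0%N = 0 /\
      forall i, (1 <= i <= k)%N -> A1 *m x i = - (A0 *m x i.-1)
  end.

Definition chain_vector p q (A0 A1 : 'M[F]_(p, q)) (lam : option F)
    (l : nat) (v : 'cV[F]_q) : Prop :=
  exists k x, (k < l)%N /\ jordan_chain A0 A1 lam k x /\
              exists2 i, (i <= k)%N & v = x i.

(* dim L^l_lam(A): dimension of the span of all such vectors, i.e. the
   largest dimension of the span of a finite family of such vectors *)
Definition Ldim p q (A0 A1 : 'M[F]_(p, q)) (lam : option F) (l : nat) : nat :=
  \max_(d < q.+1 | `[< exists s : seq 'cV[F]_q,
        (forall v, v \in s -> chain_vector A0 A1 lam l v) /\
        \dim <<s>>%VS = d >]) (d : nat).

Definition weyr p q (A0 A1 : 'M[F]_(p, q)) (lam : option F) (i : nat) : int :=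
  (Ldim A0 A1 lam i)%:Z - (Ldim A0 A1 lam i.-1)%:Z.

End Pencils.

(* Main.v *)
(** Move [lambda] to [0]: finite or infinite, the pencil becomes [M(s) = E + s H].
Sending the first vector of a chain of length [i] to its last one identifies
[w_i] with [dim T_i - dim Z_(i-1)], where [T_i] consists of the constant terms
of the solutions of [M x = 0] modulo [s^i], and [Z_d] of the constant terms of the
polynomial solutions of degree [< d] (the latter only sees the column minimal
indices). A pencil of rank one factors as [u(s) phi(s)] with [deg phi <= 1], so that
[M] and its perturbation [M + u phi] give the same spaces [T_i'] and [Z_d'] once
the equation [phi x = 0] is added. Both pencils are therefore compared with the
stacked matrix [col_mx M phi]: [T_i'] has codimension at most one in [T_i], while
[Z_d' = Z_d] as long as [d < e], where [e] is minimal such that some polynomial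
solution of degree [< e] is not killed by [phi], and for [d >= e] the codimension of
[Z_d'] in [Z_d] is between [1] and [e + 1], the value [e + 1] forcing
[T_i' <> T_i]. Whether [e] exists is read off the normal ranks. *)
Require Import Defs.
From HB Require Import structures.
From mathcomp Require Import all_boot all_order all_algebra.
From mathcomp Require Import boolp generic_quotient zify ring.
Set Implicit Arguments. Unset Strict Implicit. Unset Printing Implicit Defensive.
Import Order.TTheory GRing.Theory Num.Theory.
Local Open Scope ring_scope.

(** * Subspaces given by predicates, and their dimensions *)

Section SubspacePredicates.
Variable F : fieldType.
Implicit Types vT uT : vectType F.

Definition lin_pred vT (P : vT -> Prop) : Prop :=
  P 0 /\ forall a x y, P x -> P y -> P (a *: x + y).

(** Among the subspaces contained in [P], one of maximal dimension exhausts [P]: a further vector of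
    [P] would enlarge it. *)
Lemma lin_pred_vspace vT (P : vT -> Prop) :
  lin_pred P -> exists U : {vspace vT}, forall v, v \in U <-> P v.
Proof.
move=> [P0 PL].
pose Q d := `[< exists U : {vspace vT}, (forall v, v \in U -> P v) /\ \dim U = d >].
have exQ : exists d, Q d.
  exists 0%N; apply/asboolP; exists 0%VS; split; last by rewrite dimv0.
  by move=> v; rewrite memv0 => /eqP->.
have bQ d : Q d -> (d <= \dim {:vT})%N.
  by move=> /asboolP[U [_ <-]]; exact: dimvS (subvf U).
case: (ex_maxnP exQ bQ) => d /asboolP[U [UP dU]] dmax.
exists U => v; split; first exact: UP.
move=> Pv; apply: contraT => vU.
have /dmax : Q (\dim (<[v]> + U)).
  apply/asboolP; exists (<[v]> + U)%VS; split=> // w.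
  by case/memv_addP => _ /vlineP[c ->] [u uU ->]; apply: PL => //; apply: UP.
rewrite dimv_disjoint_sum ?dim_vline.
  case: eqVneq vU => [->|_ _]; first by rewrite mem0v.
  by rewrite dU add1n ltnn.
apply/eqP; rewrite -subv0; apply/subvP=> w /memv_capP[/vlineP[c ->]].
have [->|c0] := eqVneq c 0; first by rewrite scale0r !mem0v.
move=> cvU; case/negP: vU.
by rewrite -[v](scalerK c0) memvZ.
Qed.

(** Solution spaces arise below as existential statements, so dimension is defined on predicates.
    The default [0] is taken only when [P] is not a subspace. *)
Definition sdim vT (P : vT -> Prop) : nat :=
  if pselect (exists U : {vspace vT}, forall v, v \in U <-> P v) is left e
  then \dim (projT1 (cid e)) else 0%N.

Lemma sdimE vT (P : vT -> Prop) (U : {vspace vT}) :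
  (forall v, v \in U <-> P v) -> sdim P = \dim U.
Proof.
move=> UP; rewrite /sdim; case: pselect => [e|[]]; last by exists U.
case: (cid e) => V VP /=; congr (\dim _); apply/vspaceP => v.
by apply/idP/idP => [/VP/UP|/UP/VP].
Qed.

Lemma eq_sdim vT (P Q : vT -> Prop) : (forall v, P v <-> Q v) -> sdim P = sdim Q.
Proof. by move=> PQ; congr sdim; apply/funext => v; apply/propext. Qed.

Lemma sdimS vT (P Q : vT -> Prop) : lin_pred P -> lin_pred Q ->
  (forall v, P v -> Q v) -> (sdim P <= sdim Q)%N.
Proof.
move=> /lin_pred_vspace[U UP] /lin_pred_vspace[V VQ] PQ.
rewrite (sdimE UP) (sdimE VQ); apply: dimvS.
by apply/subvP => v /UP/PQ/VQ.
Qed.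

Lemma sdim_lt vT (P Q : vT -> Prop) v : lin_pred P -> lin_pred Q ->
  (forall v, P v -> Q v) -> Q v -> ~ P v -> (sdim P < sdim Q)%N.
Proof.
move=> /lin_pred_vspace[U UP] /lin_pred_vspace[V VQ] PQ Qv Pv.
rewrite (sdimE UP) (sdimE VQ) ltn_neqAle dimvS ?andbT; last first.
  by apply/subvP => w /UP/PQ/VQ.
apply/eqP => dUV; apply: Pv; apply/UP.
suff -> : U = V by apply/VQ.
by apply/eqP; rewrite eqEdim dUV leqnn andbT; apply/subvP => w /UP/PQ/VQ.
Qed.

Lemma sdim_full vT (P : vT -> Prop) : lin_pred P -> (sdim P <= \dim {:vT})%N.
Proof. by move=> /lin_pred_vspace[U UP]; rewrite (sdimE UP) dimvS ?subvf. Qed.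

Lemma sdim0 vT (P : vT -> Prop) : (forall v, P v <-> v = 0) -> sdim P = 0%N.
Proof.
move=> P0; rewrite (@sdimE _ _ 0%VS) ?dimv0// => v.
by rewrite memv0; split=> [/eqP/P0|/P0/eqP].
Qed.

Lemma sdim_codim1 vT (P Q : vT -> Prop) y : lin_pred P -> lin_pred Q ->
  (forall x, Q x -> exists c, P (x - c *: y)) -> (sdim Q <= (sdim P).+1)%N.
Proof.
move=> /lin_pred_vspace[U UP] /lin_pred_vspace[V VQ] PQ.
rewrite (sdimE UP) (sdimE VQ).
have /dimvS : (V <= U + <[y]>)%VS.
  apply/subvP => x /VQ/PQ[c /UP xU]; apply/memv_addP.
  exists (x - c *: y) => //; exists (c *: y); first by rewrite memvZ ?memv_line.
  by rewrite subrK.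
move/leq_trans; apply; apply: leq_trans (dimv_add_leqif _ _) _.
by rewrite dim_vline; case: (y != 0); rewrite ?addn1 ?addn0.
Qed.

Lemma sdim_inj uT vT (f : {linear uT -> vT}) (P : vT -> Prop) :
  lin_pred P -> injective f -> (forall x, P (f x)) -> (\dim {:uT} <= sdim P)%N.
Proof.
move=> /lin_pred_vspace[U UP] fI Pf; rewrite (sdimE UP).
pose g := linfun f.
have -> : \dim {:uT} = \dim (g @: fullv).
  rewrite limg_dim_eq //; apply/eqP; rewrite -subv0; apply/subvP => x.
  rewrite memv_cap memv_ker lfunE /= memv0 => /andP[_ /eqP fx0].
  by apply/eqP; apply: fI; rewrite fx0 linear0.
by apply: dimvS; apply/subvP => _ /memv_imgP[x _ ->]; apply/UP; rewrite lfunE.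
Qed.

Definition lin_rel uT vT (R : uT -> vT -> Prop) : Prop :=
  R 0 0 /\ forall a x y x' y', R x y -> R x' y' -> R (a *: x + x') (a *: y + y').

(** Both sides are the dimension of [R] as a subspace of the product, computed by rank-nullity for
    each of the two projections. *)
Lemma lin_rel_dim uT vT (R : uT -> vT -> Prop) : lin_rel R ->
  (sdim (fun x => exists y, R x y) + sdim (fun y => R 0%R y) =
   sdim (fun y => exists x, R x y) + sdim (fun x => R x 0%R))%N.
Proof.
move=> [R0 RL].
have [U UP] : exists U : {vspace (uT * vT)}, forall w, w \in U <-> R w.1 w.2.
  by apply: (@lin_pred_vspace _ (fun w => R w.1 w.2)); split=> // a [x y] [x' y'] /=; exact: RL.
pose f : 'Hom((uT * vT)%type, uT) := linfun (@fst uT vT).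
pose g : 'Hom((uT * vT)%type, vT) := linfun (@snd uT vT).
have fE x : f x = x.1 by rewrite lfunE.
have gE x : g x = x.2 by rewrite lfunE.
have e1 : sdim (fun x => exists y, R x y) = \dim (f @: U).
  apply: sdimE => x; split=> [/memv_imgP[w /UP wU ->]|[y Rxy]].
    by rewrite fE; exists w.2.
  by apply/memv_imgP; exists (x, y); rewrite ?fE //; apply/UP.
have e2 : sdim (fun y => exists x, R x y) = \dim (g @: U).
  apply: sdimE => y; split=> [/memv_imgP[w /UP wU ->]|[x Rxy]].
    by rewrite gE; exists w.1.
  by apply/memv_imgP; exists (x, y); rewrite ?gE //; apply/UP.
have e3 : sdim (fun y => R 0%R y) = \dim (U :&: lker f).
  rewrite -(@limg_dim_eq _ _ _ g); last first.
    apply/eqP; rewrite -subv0; apply/subvP => -[x y].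
    rewrite !memv_cap !memv_ker fE gE /= memv0.
    by case/andP=> /andP[_ /eqP->] /eqP->.
  apply: sdimE => y; split=> [/memv_imgP[w]|Ry].
    rewrite memv_cap memv_ker fE gE => /andP[/UP Rw /eqP w0 ->].
    by rewrite -w0.
  apply/memv_imgP; exists (0, y); rewrite ?gE //.
  by rewrite memv_cap memv_ker fE eqxx andbT; apply/UP.
have e4 : sdim (fun x => R x 0%R) = \dim (U :&: lker g).
  rewrite -(@limg_dim_eq _ _ _ f); last first.
    apply/eqP; rewrite -subv0; apply/subvP => -[x y].
    rewrite !memv_cap !memv_ker fE gE /= memv0.
    by case/andP=> /andP[_ /eqP->] /eqP->.
  apply: sdimE => x; split=> [/memv_imgP[w]|Rx].
    rewrite memv_cap memv_ker fE gE => /andP[/UP Rw /eqP w0 ->].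
    by rewrite -w0.
  apply/memv_imgP; exists (x, 0); rewrite ?fE //.
  by rewrite memv_cap memv_ker gE eqxx andbT; apply/UP.
by rewrite e1 e2 e3 e4 addnC limg_ker_dim addnC limg_ker_dim.
Qed.

End SubspacePredicates.

(** * Polynomial vectors; Jordan chains as solutions modulo a power of ['X] *)

Section PolyVectors.
Variable F : fieldType.

Definition cf m n j (x : 'M[{poly F}]_(m, n)) : 'M[F]_(m, n) := map_mx (coefp j) x.

Lemma cfE m n j (x : 'M[{poly F}]_(m, n)) r c : cf j x r c = (x r c)`_j.
Proof. by rewrite mxE. Qed.

Lemma cfD m n j (x y : 'M[{poly F}]_(m, n)) : cf j (x + y) = cf j x + cf j y.
Proof. by apply/matrixP => r c; rewrite !(mxE, cfE, coefD). Qed.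

Lemma cfZ m n j a (x : 'M[{poly F}]_(m, n)) : cf j (a%:P *: x) = a *: cf j x.
Proof. by apply/matrixP => r c; rewrite !(mxE, cfE, coefCM). Qed.

Lemma cf0 m n j : cf j (0 : 'M[{poly F}]_(m, n)) = 0.
Proof. by apply/matrixP => r c; rewrite !(mxE, cfE, coef0). Qed.

Lemma cfXn m n j i (x : 'M[{poly F}]_(m, n)) :
  cf j ('X^i *: x) = if (j < i)%N then 0 else cf (j - i) x.
Proof.
by apply/matrixP => r c; rewrite !(mxE, cfE) coefXnM; case: ifP; rewrite ?mxE ?cfE.
Qed.

Lemma cfX m n j (x : 'M[{poly F}]_(m, n)) :
  cf j ('X *: x) = if j is k.+1 then cf k x else 0.
Proof. by rewrite -['X]expr1 cfXn; case: j => [|j] //=; rewrite subn1. Qed.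

Lemma cfP m n (x y : 'M[{poly F}]_(m, n)) : (forall j, cf j x = cf j y) -> x = y.
Proof.
move=> xy; apply/matrixP => r c; apply/polyP => j.
by have /matrixP/(_ r c) := xy j; rewrite !cfE.
Qed.

Lemma cfCM m n k j (A : 'M[F]_(m, n)) (x : 'M[{poly F}]_(n, k)) :
  cf j (map_mx polyC A *m x) = A *m cf j x.
Proof.
apply/matrixP => r c; rewrite cfE !mxE coef_sum; apply: eq_bigr => i _.
by rewrite !mxE coefCM.
Qed.

Lemma cf0M m n k (A : 'M[{poly F}]_(m, n)) (x : 'M[{poly F}]_(n, k)) :
  cf 0 (A *m x) = cf 0 A *m cf 0 x.
Proof.
apply/matrixP => r c; rewrite cfE !mxE coef_sum; apply: eq_bigr => i _.
by rewrite !mxE coef0M.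
Qed.

Definition vanish m n i (x : 'M[{poly F}]_(m, n)) : Prop := exists y, x = 'X^i *: y.

Lemma vanishP m n i (x : 'M[{poly F}]_(m, n)) :
  vanish i x <-> forall j, (j < i)%N -> cf j x = 0.
Proof.
split=> [[y -> j ji]|x0]; first by rewrite cfXn ji.
exists (map_mx (drop_poly i) x); apply: cfP => j; rewrite cfXn.
case: ltnP => [/x0//|ij]; apply/matrixP => r c.
by rewrite !(mxE, cfE) coef_drop_poly subnK.
Qed.

Lemma vanish0 m n i : vanish i (0 : 'M[{poly F}]_(m, n)).
Proof. by exists 0; rewrite scaler0. Qed.

Lemma vanishD m n i (x y : 'M[{poly F}]_(m, n)) :
  vanish i x -> vanish i y -> vanish i (x + y).
Proof. by move=> [u ->] [v ->]; exists (u + v); rewrite scalerDr. Qed.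

Lemma vanishZ m n i a (x : 'M[{poly F}]_(m, n)) : vanish i x -> vanish i (a *: x).
Proof. by move=> [u ->]; exists (a *: u); rewrite !scalerA mulrC. Qed.

Lemma vanish_col m1 m2 n i (x : 'M[{poly F}]_(m1, n)) (y : 'M_(m2, n)) :
  vanish i (col_mx x y) <-> vanish i x /\ vanish i y.
Proof.
split=> [[z]|[[u ->] [v ->]]].
  by rewrite -[z]vsubmxK scale_col_mx => /eq_col_mx[-> ->]; split; eexists.
by exists (col_mx u v); rewrite scale_col_mx.
Qed.

Lemma vanishXS m n i (x : 'M[{poly F}]_(m, n)) :
  vanish i.+1 ('X *: x) <-> vanish i x.
Proof.
split=> /vanishP h; apply/vanishP => j ji; first by have := h j.+1 ji; rewrite cfX.
by rewrite cfX; case: j ji => // j /h.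
Qed.

Lemma cf0_eq0 m n (x : 'M[{poly F}]_(m, n)) : cf 0 x = 0 -> exists y, x = 'X *: y.
Proof.
move=> x0; have [y ->] : vanish 1 x by apply/vanishP => -[|j].
by exists y; rewrite expr1.
Qed.

Lemma mulX_inj m n (x y : 'M[{poly F}]_(m, n)) : 'X *: x = 'X *: y -> x = y.
Proof. by move=> h; apply: cfP => j; have := congr1 (cf j.+1) h; rewrite !cfX. Qed.

Definition vsize q (x : 'cV[{poly F}]_q) (d : nat) : Prop :=
  forall r, (size (x r 0%R) <= d)%N.

Lemma vsizeP q (x : 'cV[{poly F}]_q) d :
  vsize x d <-> forall j, (d <= j)%N -> cf j x = 0.
Proof.
split=> [h j dj|h r].
  by apply/colP => r; rewrite cfE mxE; apply/leq_sizeP/dj/h.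
by apply/leq_sizeP => j /h/colP/(_ r); rewrite cfE mxE.
Qed.

(** These are the spaces T_i ([lead M i]) and Z_d ([kerval M d]) of the opening outline. *)
Definition lead p q (M : 'M[{poly F}]_(p, q)) i (v : 'cV[F]_q) : Prop :=
  exists x, vanish i (M *m x) /\ cf 0 x = v.
Definition kerval p q (M : 'M[{poly F}]_(p, q)) d (v : 'cV[F]_q) : Prop :=
  exists x, [/\ M *m x = 0, vsize x d & cf 0 x = v].
(* The factor ['X] shifts the index by one, so that [tail M 0] is the zero space;
   [tail M i] is the span of the Jordan chains of length at most [i]. *)
Definition tail p q (M : 'M[{poly F}]_(p, q)) i (v : 'cV[F]_q) : Prop :=
  exists x, vanish i (M *m x) /\ cf i ('X *: x) = v.

Lemma vsizeD q d a (x y : 'cV[{poly F}]_q) :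
  vsize x d -> vsize y d -> vsize (a%:P *: x + y) d.
Proof.
move=> /vsizeP hx /vsizeP hy; apply/vsizeP => j dj.
by rewrite cfD cfZ hx// hy// scaler0 addr0.
Qed.

Lemma vsize0 q d : vsize (0 : 'cV[{poly F}]_q) d.
Proof. by apply/vsizeP => j _; rewrite cf0. Qed.

Lemma mulmx_comb p q (M : 'M[{poly F}]_(p, q)) a (x y : 'cV_q) :
  M *m (a *: x + y) = a *: (M *m x) + M *m y.
Proof. by rewrite mulmxDr -scalemxAr. Qed.

Lemma lead_lin p q (M : 'M[{poly F}]_(p, q)) i : lin_pred (lead M i).
Proof.
split; first by exists 0; rewrite mulmx0 cf0; split=> //; exact: vanish0.
move=> a _ _ [x [hx <-]] [y [hy <-]]; exists (a%:P *: x + y).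
by rewrite mulmx_comb cfD cfZ; split=> //; apply/vanishD/hy/vanishZ.
Qed.

Lemma kerval_lin p q (M : 'M[{poly F}]_(p, q)) d : lin_pred (kerval M d).
Proof.
split; first by exists 0; rewrite mulmx0 cf0; split=> //; exact: vsize0.
move=> a _ _ [x [hx sx <-]] [y [hy sy <-]]; exists (a%:P *: x + y).
rewrite mulmx_comb cfD cfZ hx hy scaler0 addr0; split=> //; exact: vsizeD.
Qed.

Lemma tail_lin p q (M : 'M[{poly F}]_(p, q)) i : lin_pred (tail M i).
Proof.
split; first by exists 0; rewrite mulmx0 scaler0 cf0; split=> //; exact: vanish0.
move=> a _ _ [x [hx <-]] [y [hy <-]]; exists (a%:P *: x + y).
rewrite mulmx_comb scalerDr scalerA mulrC -scalerA cfD cfZ.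
by split=> //; apply/vanishD/hy/vanishZ.
Qed.

Lemma pencil_polyE p q (E H : 'M[F]_(p, q)) :
  pencil_poly E H = map_mx polyC E + 'X *: map_mx polyC H.
Proof. by apply/matrixP => i j; rewrite !mxE mulrC. Qed.

Lemma cf_pencil p q (E H : 'M[F]_(p, q)) j (x : 'cV_q) :
  cf j (pencil_poly E H *m x) = E *m cf j x + H *m cf j ('X *: x).
Proof. by rewrite pencil_polyE mulmxDl -scalemxAl scalemxAr cfD !cfCM. Qed.

(** Solutions modulo ['X^i] are related through their coefficients of degree [0] and [i.-1]; the
    four terms are those of [lin_rel_dim] for this relation. *)
Lemma tail_sub_kerval p q (E H : 'M[F]_(p, q)) (M := pencil_poly E H) i :
  (0 < i)%N ->
  (sdim (lead M i) + sdim (tail M i.-1) = sdim (tail M i) + sdim (kerval M i.-1))%N.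
Proof.
case: i => // i _ /=.
pose R (v w : 'cV[F]_q) := exists x, [/\ vanish i.+1 (M *m x), cf 0 x = v & cf i x = w].
have Rlin : lin_rel R.
  split; first by exists 0; rewrite mulmx0 !cf0; split=> //; exact: vanish0.
  move=> a _ _ _ _ [x [hx <- <-]] [y [hy <- <-]]; exists (a%:P *: x + y).
  by rewrite mulmx_comb !cfD !cfZ; split=> //; apply/vanishD/hy/vanishZ.
have := lin_rel_dim Rlin.
rewrite (@eq_sdim _ _ (fun v => exists w, R v w) (lead M i.+1)); last first.
  move=> v; split=> [[w [x [h e _]]]|[x [h e]]]; first by exists x.
  by exists (cf i x); exists x.
rewrite (@eq_sdim _ _ (fun w => R 0 w) (tail M i)); last first.
  move=> w; split=> [[x [h e e']]|[x [h e]]].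
    have [y yx] := cf0_eq0 e; exists y; rewrite -yx; split=> //.
    by move: h; rewrite yx -scalemxAr => /vanishXS.
  exists ('X *: x); rewrite cfX -scalemxAr; split=> //; exact/vanishXS.
rewrite (@eq_sdim _ _ (fun w => exists v, R v w) (tail M i.+1)); last first.
  move=> w; split=> [[v [x [h _ e]]]|[x [h]]]; rewrite ?cfX.
    by exists x; rewrite cfX.
  by move=> e; exists (cf 0 x); exists x.
move=> ->; congr (_ + _)%N; apply: eq_sdim => v.
split=> [[x [/vanishP h e e']]|[x [h /vsizeP s e]]]; last first.
  exists x; rewrite h (s i)//; split=> //; exact: vanish0.
(* As coefficient [i] of [x] is zero, truncation keeps the coefficients of [M *m x] up to degree [i]
   and kills the higher ones, so [y] is an exact solution. *)
pose y := map_mx (take_poly i) x.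
have cy j : cf j y = if (j < i)%N then cf j x else 0.
  apply/colP => r; rewrite !(mxE, cfE) coef_take_poly.
  by case: ifP; rewrite ?mxE ?cfE.
have cy' j : (j <= i)%N -> cf j y = cf j x.
  by rewrite cy leq_eqVlt; case: ltnP => // ij; rewrite orbF => /eqP->.
exists y; split.
- apply: cfP => j; rewrite cf0; have [ij|ji] := ltnP i j.
    rewrite cf_pencil cfX; case: j ij => // j ij.
    by rewrite !cy !ifN ?mulmx0 ?addr0 //; lia.
  rewrite -(h j)// !cf_pencil !cfX cy'//; case: j ji => // j ji.
  by rewrite cy'// ltnW.
- by apply/vsizeP => j ij; rewrite cy ltnNge ij.
- by rewrite cy'.
Qed.

(** [trM lam A0 A1] is A(l + s) for finite [l] and the reversal s A(1/s) at infinity; in both cases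
    the Jordan chain equations become the coefficients of M x = 0. *)
Definition trE p q (lam : option F) (A0 A1 : 'M[F]_(p, q)) : 'M[F]_(p, q) :=
  if lam is Some l then A0 + l *: A1 else A1.
Definition trH p q (lam : option F) (A0 A1 : 'M[F]_(p, q)) : 'M[F]_(p, q) :=
  if lam is Some _ then A1 else A0.
Definition trM p q (lam : option F) (A0 A1 : 'M[F]_(p, q)) : 'M[{poly F}]_(p, q) :=
  pencil_poly (trE lam A0 A1) (trH lam A0 A1).

Lemma jordan_chainE p q (A0 A1 : 'M[F]_(p, q)) lam k x :
  jordan_chain A0 A1 lam k x <->
  [/\ x 0%N != 0, trE lam A0 A1 *m x 0%N = 0 &
   forall i, (1 <= i <= k)%N -> trE lam A0 A1 *m x i = - (trH lam A0 A1 *m x i.-1)].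
Proof. by case: lam => [l|]; rewrite /jordan_chain /=; split=> [[? []]|[]]. Qed.

Lemma chain_vector_tail p q (A0 A1 : 'M[F]_(p, q)) lam l v :
  chain_vector A0 A1 lam l v -> tail (trM lam A0 A1) l v.
Proof.
move=> [k [x [kl [/jordan_chainE[x0 Ex0 Ex] [m mk ->]]]]].
(* This shift puts [x m] in degree [l.-1], the coefficient that [tail] reads; the chain vectors
   after [x m] are dropped. *)
pose s := (l.-1 - m)%N.
pose y : 'cV[{poly F}]_q := 'X^s *: \sum_(j < m.+1) 'X^j *: map_mx polyC (x j).
have cy j : cf j y = if (s <= j <= s + m)%N then x (j - s)%N else 0.
  rewrite cfXn; case: ltnP => //= sj; apply/colP => r.
  rewrite cfE summxE coef_sum.
  have [jm|jm] := leqP j (s + m).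
    have jsm : (j - s < m.+1)%N by rewrite ltnS leq_subLR.
    rewrite (bigD1 (Ordinal jsm))//= !mxE coefXnM ltnn subnn coefC eqxx.
    rewrite big1 ?addr0// => i ij; rewrite !mxE coefXnM coefC.
    case: ltnP => // ij'; case: eqP => // e; case/eqP: ij; apply/val_inj => /=.
    by lia.
  rewrite mxE big1// => i _; rewrite !mxE coefXnM coefC.
  by case: ltnP => // ij'; case: eqP => // e; have := ltn_ord i; lia.
exists y; split; last first.
  case: l @s y cy kl => // l s y cy kl; rewrite cfX cy.
  have -> : (s <= l <= s + m)%N by rewrite /s /=; lia.
  by congr x; rewrite /s /=; lia.
apply/vanishP => j jl; rewrite cf_pencil cfX.
case: j jl => [|j] jl; rewrite !cy ?mulmx0 ?addr0.
  case: ifP => h; last by rewrite mulmx0.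
  by rewrite sub0n.
have jm : (j.+1 <= s + m)%N by rewrite /s; lia.
have [js|sj] := ltnP j.+1 s; first by rewrite !ifN ?mulmx0 ?addr0 //; lia.
have [e|ne] := eqVneq j.+1 s.
  rewrite ifT; last by lia.
  by rewrite e subnn Ex0 ifN ?mulmx0 ?addr0 //; lia.
rewrite !ifT; [|lia|lia]; rewrite subSn; last by lia.
by rewrite Ex /= ?addNr //; lia.
Qed.

(** The chain starts at the first nonzero coefficient of the solution, which exists because [v] is
    one of the coefficients. *)
Lemma tail_chain_vector p q (A0 A1 : 'M[F]_(p, q)) lam l v :
  tail (trM lam A0 A1) l v -> v != 0 -> chain_vector A0 A1 lam l v.
Proof.
case: l => [|l] [x [/vanishP h]]; rewrite cfX => <-; first by rewrite eqxx.
move=> cx0.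
have ex0 : exists j, cf j x != 0 by exists l.
case: (ex_minnP ex0) => j0 j0x j0min.
have j0l := j0min _ cx0.
exists (l - j0)%N, (fun j => cf (j0 + j) x); split; first by lia.
split; last by exists (l - j0)%N => //; rewrite subnKC.
have small j : (j < j0)%N -> cf j x = 0.
  by move=> jj; apply/eqP; apply: contraTT jj => /j0min; rewrite leqNgt.
apply/jordan_chainE; split; first by rewrite addn0.
  have := h j0 j0l; rewrite cf_pencil cfX addn0 => <-.
  by case: j0 small {j0x j0min j0l} => [|j0] small; rewrite ?(small j0) ?mulmx0 ?addr0.
move=> i /andP[i0 ij]; have := h (j0 + i)%N; rewrite cf_pencil cfX.
case: i i0 ij => // i _ ij; rewrite addnS => e.
by apply/eqP; rewrite -addr_eq0 e//; lia.
Qed.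

(** Chain vectors lie in the subspace [tail], and a basis of that subspace consists of nonzero
    vectors, each of which belongs to a chain. *)
Lemma LdimE p q (A0 A1 : 'M[F]_(p, q)) lam l :
  Ldim A0 A1 lam l = sdim (tail (trM lam A0 A1) l).
Proof.
have [U UP] := lin_pred_vspace (tail_lin (trM lam A0 A1) l).
rewrite (sdimE UP); apply/eqP; rewrite eqn_leq; apply/andP; split.
  apply/bigmax_leqP => d /asboolP[s [sP <-]]; apply/dimvS/span_subvP => v vs.
  by apply/UP/chain_vector_tail/sP.
have dU : (\dim U < q.+1)%N.
  by rewrite ltnS; apply: leq_trans (dimvS (subvf U)) _; rewrite dimvf dim_matrix; lia.
apply: (@leq_bigmax_cond _ _ _ (Ordinal dU)); apply/asboolP => /=.
exists (vbasis U); split; last by rewrite (span_basis (vbasisP U)).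
move=> v vU; apply: tail_chain_vector; first by apply/UP/vbasis_mem.
by have /basis_not0 := vbasisP U; apply.
Qed.

Lemma weyrE p q (A0 A1 : 'M[F]_(p, q)) lam i (M := trM lam A0 A1) : (0 < i)%N ->
  weyr A0 A1 lam i = (sdim (lead M i))%:Z - (sdim (kerval M i.-1))%:Z.
Proof.
move=> i0; rewrite /weyr !LdimE -/M.
by have := tail_sub_kerval (trE lam A0 A1) (trH lam A0 A1) i0; rewrite -/(trM lam A0 A1) -/M; lia.
Qed.

End PolyVectors.

(** * The effect of one extra equation [phi *m x = 0] on T_i and Z_d *)

Section RankOneStep.
Variable F : fieldType.

Lemma size_mul_le (a b : {poly F}) m n k :
  (size a <= m)%N -> (size b <= n)%N -> ((m + n).-1 <= k)%N -> (size (a * b)%R <= k)%N.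
Proof. by move=> am bn; apply: leq_trans; have := size_polyMleq a b; lia. Qed.

Variables (p q : nat) (M : 'M[{poly F}]_(p, q)) (phi : 'rV[{poly F}]_q).
Notation M' := (col_mx M phi).
Notation ev x := ((phi *m (x : 'cV[{poly F}]_q)) 0 0).

Lemma ev_comb (a : {poly F}) (x y : 'cV_q) : ev (a *: x + y) = a * ev x + ev y.
Proof. by rewrite mulmx_comb !mxE. Qed.

Lemma phi_eq0 (x : 'cV_q) : phi *m x = 0 <-> ev x = 0.
Proof. by split=> [->|h]; [rewrite mxE | apply/matrixP => i j; rewrite !ord1 h mxE]. Qed.

Lemma ker_col (x : 'cV_q) : M' *m x = 0 <-> M *m x = 0 /\ ev x = 0.
Proof.
rewrite mul_col_mx -phi_eq0; split=> [/eqP|[-> ->]]; last by rewrite col_mx0.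
by rewrite col_mx_eq0 => /andP[/eqP-> /eqP->].
Qed.

Lemma vanish_colM i (x : 'cV_q) : vanish i (M' *m x) <->
  vanish i (M *m x) /\ forall j, (j < i)%N -> (ev x)`_j = 0.
Proof.
rewrite mul_col_mx vanish_col (vanishP _ (phi *m x)).
split=> -[h h']; split=> // j /h'; first by move/matrixP/(_ 0 0); rewrite cfE [RHS]mxE.
by move=> e; apply/matrixP => r c; rewrite cfE !ord1 e [RHS]mxE.
Qed.

Lemma coef_mul_low n (g h : {poly F}) : (forall j, (j < n)%N -> g`_j = 0) ->
  (g * h)`_n = g`_n * h`_0.
Proof.
move=> g0; rewrite coefM big_ord_recr /= subnn big1 ?add0r// => i _.
by rewrite g0 ?mul0r.
Qed.

Lemma cf_mul_low m n (g : {poly F}) k (x : 'M_(m, n)) :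
  (forall j, (j < k)%N -> g`_j = 0) -> cf k (g *: x) = g`_k *: cf 0 x.
Proof. by move=> g0; apply/matrixP => r c; rewrite cfE mxE coef_mul_low// mxE cfE. Qed.

Lemma sdim_lead_col i : (sdim (lead M' i) <= sdim (lead M i))%N.
Proof.
apply: sdimS; [exact: lead_lin | exact: lead_lin |].
by move=> v [x [/vanish_colM[h _] e]]; exists x.
Qed.

(* Let [y] be a solution modulo ['X^i] whose image [ev y] has minimal order; then
   [ev x] is a multiple of [ev y] modulo ['X^i] for every other solution [x]. *)
Lemma sdim_lead_codim1 i : (sdim (lead M i) <= (sdim (lead M' i)).+1)%N.
Proof.
pose Q n := `[< exists y, [/\ vanish i (M *m y), (n < i)%N & (ev y)`_n != 0] >].
have [exQ|noQ] := pselect (exists n, Q n); last first.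
  rewrite leqW//; apply: sdimS; [exact: lead_lin | exact: lead_lin |].
  move=> v [x [h e]]; exists x; split=> //; apply/vanish_colM; split=> // j ji.
  apply/eqP; apply: contra_notT noQ => nz; exists j; apply/asboolP.
  by exists x.
case: (ex_minnP exQ) => n /asboolP[y [My ni yn]] nmin.
have low x j : vanish i (M *m x) -> (j < n)%N -> (ev x)`_j = 0.
  move=> Mx jn; apply/eqP; apply: contraTT jn => nz; rewrite -leqNgt.
  have [ji|/(leq_trans _)->//] := ltnP j i; last exact: ltnW.
  by apply: nmin; apply/asboolP; exists x.
apply: (@sdim_codim1 _ _ _ _ (cf 0 y)); [exact: lead_lin | exact: lead_lin |].
move=> _ [x [Mx <-]].
have [g hg] : exists g : {poly F}, forall j, (j < i)%N -> (ev (x - g *: y))`_j = 0.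
  (* The coefficients of the multiplier [g] are found one after the other, dividing by the lowest
     coefficient of [ev y]. *)
  have : forall k, exists g : {poly F}, forall j, (j < n + k)%N -> (ev (x - g *: y))`_j = 0.
    elim=> [|k [g IH]].
      exists 0 => j; rewrite addn0 scale0r subr0; exact: low.
    pose c := (ev (x - g *: y))`_(n + k) / (ev y)`_n.
    exists (g + c%:P * 'X^k) => j; rewrite addnS ltnS leq_eqVlt => jn.
    have -> : x - (g + c%:P * 'X^k) *: y = (- (c%:P * 'X^k)) *: y + (x - g *: y).
      by rewrite scaleNr scalerDl opprD addrA [RHS]addrC.
    rewrite ev_comb mulNr coefD coefN -mulrA coefCM coefXnM.
    case/orP: jn => [/eqP ->|jn].
      by rewrite ltnNge leq_addl /= addnK /c divfK// addNr.
    rewrite IH// addr0; case: ltnP => kj; first by rewrite mulr0 oppr0.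
    by rewrite (low y) ?mulr0 ?oppr0//; lia.
  move=> /(_ (i - n)%N)[g hg]; exists g => j ji; apply: hg; lia.
exists g`_0, (x - g *: y); split.
  apply/vanish_colM; split=> //.
  by rewrite mulmxBr -scalemxAr -scaleNr; apply/vanishD/vanishZ.
by apply/colP => r; rewrite !(mxE, cfE) coefB coef0M.
Qed.

(** Every vector of [lead M' i] is killed by the constant term of [phi], but the constant term of
    [z] is not. *)
Lemma sdim_lead_lt i (z : 'cV_q) : (0 < i)%N -> M *m z = 0 -> (ev z)`_0 != 0 ->
  (sdim (lead M' i) < sdim (lead M i))%N.
Proof.
move=> i0 Mz ez; apply: (@sdim_lt _ _ _ _ (cf 0 z)); [exact: lead_lin | exact: lead_lin | | |].
- by move=> v [x [/vanish_colM[h _] e]]; exists x.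
- by exists z; rewrite Mz; split=> //; exact: vanish0.
move=> [x [/vanish_colM[_ /(_ _ i0)] ex e]].
have e0 : cf 0 (phi *m x) = cf 0 (phi *m z) by rewrite !cf0M e.
by have /matrixP/(_ 0 0) := e0; rewrite !cfE ex => /esym/eqP; rewrite (negPf ez).
Qed.

Lemma sdim_kerval_col_eq d :
  (forall z, M *m z = 0 -> vsize z d -> ev z = 0) ->
  sdim (kerval M' d) = sdim (kerval M d).
Proof.
move=> h; apply: eq_sdim => v; split=> -[x [h1 h2 h3]]; exists x; split=> //.
  by case/ker_col: h1.
by apply/ker_col; split=> //; exact: h.
Qed.

(** Take a solution [y] with [ev y] of minimal order. Were [cf 0 y] also the constant term of a
    solution [x] with [ev x = 0], then [y - x] divided by ['X] would be a solution whose image has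
    smaller order. *)
Lemma sdim_kerval_lt d (z : 'cV_q) : M *m z = 0 -> vsize z d -> ev z != 0 ->
  (sdim (kerval M' d) < sdim (kerval M d))%N.
Proof.
move=> Mz sz ez.
pose Q n := `[< exists y, [/\ M *m y = 0, vsize y d & (ev y)`_n != 0] >].
have exQ : exists n, Q n.
  by exists (size (ev z)).-1; apply/asboolP; exists z; rewrite -lead_coefE lead_coef_eq0.
case: (ex_minnP exQ) => n /asboolP[y [My sy yn]] nmin.
apply: (@sdim_lt _ _ _ _ (cf 0 y)); [exact: kerval_lin | exact: kerval_lin | | |].
- by move=> v [x [/ker_col[h _] s e]]; exists x.
- by exists y.
move=> [x [/ker_col[Mx ex] sx e]].
have [w hw] : exists w, y - x = 'X *: w.
  by apply: cf0_eq0; apply/colP => r; have /colP/(_ r) := e; rewrite !(mxE, cfE) coefB => ->; rewrite subrr.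
have evw : ev y = 'X * ev w.
  have := ev_comb 'X w 0; rewrite addr0 -hw mulmx0 => e1.
  have := ev_comb (-1) x y; rewrite scaleN1r addrC e1 ex mulr0 add0r => <-.
  by rewrite [(0 : 'M_1) 0 0]mxE addr0.
case: n yn nmin => [|n]; rewrite evw coefXM ?eqxx//= => wn /(_ n).
rewrite ltnn; move=> h; suff : false by []; apply: h; apply/asboolP; exists w; split=> //.
  by apply: (@mulX_inj F); rewrite scalemxAr -hw mulmxBr My Mx subrr scaler0.
apply/vsizeP => j dj; have := congr1 (cf j.+1) hw; rewrite cfX => <-.
move/vsizeP: sy => sy; move/vsizeP: sx => sx.
have := cfD j.+1 y (- x); rewrite sy ?leqW// => ->; rewrite add0r.
apply/colP => r; have /colP/(_ r) := sx j.+1 (leqW dj).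
by rewrite !(mxE, cfE) coefN => ->; rewrite oppr0.
Qed.

Hypothesis phi2 : forall c, (size (phi 0%R c) <= 2)%N.

Lemma size_ev d (x : 'cV_q) : vsize x d -> (size (ev x) <= d.+1)%N.
Proof.
move=> sx; rewrite mxE; apply: (leq_trans (size_sum _ _ _)).
by apply/bigmax_leqP => c _; apply: (size_mul_le (phi2 c) (sx c)).
Qed.

(** Solutions of degree below [d] relate [cf 0 x] to [ev x]. The images lie in a space of dimension
    [d.+1], and those coming from [cf 0 x = 0] have dimension at least [d - e]; [lin_rel_dim] bounds
    the drop by the difference [e.+1]. *)
Lemma sdim_kerval_le d e (z : 'cV_q) : (e <= d)%N ->
  M *m z = 0 -> vsize z e -> ev z != 0 ->
  (sdim (kerval M d) <= sdim (kerval M' d) + e.+1)%N /\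
  ((forall x, M *m x = 0 -> (ev x)`_0 = 0) ->
    (sdim (kerval M d) <= sdim (kerval M' d) + e)%N).
Proof.
move=> ed Mz sz ez.
pose R (v : 'cV[F]_q) (g : 'rV[F]_d.+1) :=
  exists x, [/\ M *m x = 0, vsize x d, cf 0 x = v & poly_rV (ev x) = g].
have Rlin : lin_rel R.
  split.
    exists 0; rewrite !mulmx0 cf0 mxE linear0; split=> //; exact: vsize0.
  move=> a _ _ _ _ [x [hx sx <- <-]] [y [hy sy <- <-]]; exists (a%:P *: x + y).
  rewrite mulmx_comb hx hy scaler0 addr0 ev_comb mul_polyC linearP cfD cfZ.
  by split=> //; exact: vsizeD.
have := lin_rel_dim Rlin.
rewrite (@eq_sdim _ _ (fun v => exists w, R v w) (kerval M d)); last first.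
  move=> v; split=> [[w [x [h s e' _]]]|[x [h s e']]]; first by exists x.
  by exists (poly_rV (ev x)), x.
rewrite (@eq_sdim _ _ (fun v => R v 0) (kerval M' d)); last first.
  move=> v; split=> [[x [h s e' g0]]|[x [/ker_col[h e0] s e']]]; exists x; split=> //.
    apply/ker_col; split=> //; rewrite -(poly_rV_K (size_ev s)) g0; exact: linear0.
  by rewrite e0 linear0.
set k1 := sdim (kerval M d); set k' := sdim (kerval M' d).
set lo := sdim (fun g => R 0 g); set rg := sdim (fun g => exists v, R v g) => dimE.
(* The solutions [(r * 'X) *: z] with [size r <= d - e] have constant term zero, and [r] can be
   recovered from their images. *)
have low : (d - e <= lo)%N.
  pose f : {linear 'rV[F]_(d - e) -> 'rV[F]_d.+1} :=
    (poly_rV \o (('X * ev z) \o* rVpoly))%FUN.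
  have := @sdim_inj F 'rV[F]_(d - e) 'rV[F]_d.+1 f (fun g => R 0 g).
  rewrite dimvf dim_matrix mul1r; apply.
  - have [R0 RL] := Rlin; split=> // a x y hx hy.
    by have := RL a _ _ _ _ hx hy; rewrite scaler0 addr0.
  - move=> r r' /= e'.
    have sr (s : 'rV[F]_(d - e)) : (size (rVpoly s * ('X * ev z))%R <= d.+1)%N.
      apply: (size_mul_le (n := e.+2) (size_poly _ _)); last by lia.
      by apply: (size_mul_le (m := 2) _ (size_ev sz)) => //; rewrite size_polyX.
    have := congr1 rVpoly e'; rewrite !poly_rV_K// => /mulIf h.
    by apply: (can_inj rVpolyK); apply: h; rewrite mulf_neq0// polyX_eq0.
  move=> r; exists ((rVpoly r * 'X) *: z); split.
  - by rewrite -scalemxAr Mz scaler0.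
  - move=> c; rewrite mxE; apply: (size_mul_le (m := (d - e).+1) _ (sz c)); last by lia.
    apply: (size_mul_le (n := 2) (size_poly _ _)); last by lia.
    by rewrite size_polyX.
  - by apply/colP => c; rewrite !(mxE, cfE) -mulrA mulrCA coefXM.
  - by rewrite /= -scalemxAr mxE mulrA.
have linG : lin_pred (fun g => exists v, R v g).
  have [R0 RL] := Rlin; split; first by exists 0.
  by move=> a x y [v hv] [w hw]; exists (a *: v + w); apply: RL.
split.
  suff : (rg <= d.+1)%N by lia.
  by apply: leq_trans (sdim_full linG) _; rewrite dimvf dim_matrix mul1r.
move=> ev0.
(* If all images vanish at [0], the constant [1] is not among them, which saves one dimension. *)
suff : (rg < d.+1)%N by lia.
have -> : d.+1 = sdim (fun _ : 'rV[F]_d.+1 => True).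
  by rewrite (@sdimE _ _ _ fullv) ?dimvf ?dim_matrix ?mul1r// => v; rewrite memvf.
apply: (@sdim_lt _ _ _ _ (poly_rV 1)) => //.
move=> [v [x [Mx _ _]]] /rowP/(_ ord0); rewrite ![poly_rV _ _ _]mxE /= ev0// coef1 /=.
by move/esym/eqP; rewrite oner_eq0.
Qed.

(** For solutions [x] and [y] the vector [ev y *: x - ev x *: y] is killed by [M'], hence zero, so
    any two solutions are proportional over the rational functions. *)
Lemma sdim_kerval_le1 d : (forall x : 'cV_q, M' *m x = 0 -> x = 0) ->
  (sdim (kerval M d) <= 1)%N.
Proof.
move=> inj'.
pose Q n := `[< exists y, [/\ M *m y = 0 & (ev y)`_n != 0] >].
have [exQ|noQ] := pselect (exists n, Q n); last first.
  rewrite sdim0// => v; split=> [[x [Mx _ <-]]|->]; last first.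
    by exists 0; rewrite mulmx0 cf0; split=> //; exact: vsize0.
  rewrite (inj' x) ?cf0//; apply/ker_col; split=> //; apply/polyP => j; rewrite coef0.
  by apply/eqP; apply: contra_notT noQ => nz; exists j; apply/asboolP; exists x.
case: (ex_minnP exQ) => n /asboolP[y [My yn]] nmin.
have low x j : M *m x = 0 -> (j < n)%N -> (ev x)`_j = 0.
  move=> Mx jn; apply/eqP; apply: contraTT jn => nz; rewrite -leqNgt.
  by apply: nmin; apply/asboolP; exists x.
have z0 : sdim (fun v : 'cV[F]_q => v = 0) = 0%N by exact: sdim0.
suff : (sdim (kerval M d) <= (sdim (fun v : 'cV[F]_q => v = 0%R)).+1)%N by rewrite z0.
apply: (@sdim_codim1 _ _ _ _ (cf 0 y)); [|exact: kerval_lin|].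
  by split=> // a _ _ -> ->; rewrite scaler0 addr0.
move=> _ [x [Mx _ <-]].
have e : ev y *: x = ev x *: y.
  apply/eqP; rewrite -subr_eq0 -scaleNr addrC; apply/eqP/inj'/ker_col; split.
    by rewrite mulmx_comb -scalemxAr Mx My !scaler0 addr0.
  by rewrite ev_comb -scalemxAr [X in _ + X]mxE mulNr [ev y * _]mulrC addNr.
exists ((ev x)`_n / (ev y)`_n).
(* No image has order below [n], so in degree [n] only the constant terms of [x] and [y] remain. *)
have := congr1 (cf n) e; rewrite !cf_mul_low => [e1|j|j]; try exact: low.
apply/eqP; rewrite subr_eq0; apply/eqP; apply: (scalerI yn).
by rewrite e1 scalerA mulrCA divff// mulr1.
Qed.

(** This is the drop of dim T_i - dim Z_(i-1) caused by [phi]. A pencil and its perturbation share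
    the stacked term, so Delta_i is a difference of two gaps. *)
Definition gap i : int :=
  ((sdim (lead M i))%:Z - (sdim (kerval M i.-1))%:Z) -
  ((sdim (lead M' i))%:Z - (sdim (kerval M' i.-1))%:Z).

Definition escapes : Prop := exists z : 'cV_q, M *m z = 0 /\ ev z != 0.

Lemma gap_not_escapes i : ~ escapes -> 0 <= gap i <= 1.
Proof.
move=> ne; have := sdim_lead_col i; have := sdim_lead_codim1 i.
rewrite /gap (@sdim_kerval_col_eq i.-1); first by lia.
by move=> z Mz _; apply/eqP; apply: contra_notT ne => ez; exists z.
Qed.

(** The witness is the least [e] such that some solution of degree below [e] is not killed by [phi].
    For [i <= e] only T_i can shrink, by at most one; for [i > e] also Z_(i-1) shrinks. The last
    clause serves the regular cases, where dim Z_(i-1) is at most one. *)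
Lemma gap_escapes : escapes -> exists a, [/\ (0 < a)%N,
  (forall i, (i <= a)%N -> 0 <= gap i <= 1),
  (forall i, (a < i)%N -> - a%:Z <= gap i <= 0) &
  (forall x : 'cV_q, M' *m x = 0 -> x = 0) -> forall i, (a < i)%N -> -1 <= gap i].
Proof.
move=> [z0 [Mz0 ez0]].
pose Q n := `[< exists y, [/\ M *m y = 0, vsize y n & ev y != 0] >].
have exQ : exists n, Q n.
  exists (\max_r size (z0 r 0%R)); apply/asboolP; exists z0; split=> // r.
  exact: (leq_bigmax_cond (F := fun r => size (z0 r 0%R))).
case: (ex_minnP exQ) => e /asboolP[z [Mz sz ez]] emin.
exists e.
have e0 : (0 < e)%N.
  case: e sz {emin} => // sz; move: ez; suff -> : z = 0 by rewrite mulmx0 mxE eqxx.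
  by apply: cfP => j; rewrite cf0; move/vsizeP: sz => ->.
have gt i : (e < i)%N -> (sdim (kerval M' i.-1) < sdim (kerval M i.-1))%N.
  move=> ei; apply: (@sdim_kerval_lt _ z) => // r; apply: leq_trans (sz r) _; lia.
split=> // [i ie|i ei|inj' i ei].
- have := sdim_lead_col i; have := sdim_lead_codim1 i.
  rewrite /gap (@sdim_kerval_col_eq i.-1); first by lia.
  move=> y My sy; apply/eqP; apply/negPn/negP => ey.
  have : Q i.-1 by apply/asboolP; exists y.
  by move/emin; lia.
- have := sdim_lead_col i; have := sdim_lead_codim1 i; have := gt i ei.
  have ed : (e <= i.-1)%N by lia.
  have [k1 k2] := sdim_kerval_le ed Mz sz ez.
  (* Either T_i drops too and offsets the extreme drop [e.+1] of Z_(i-1), or all images vanish at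
     [0] and Z_(i-1) drops by at most [e]. *)
  have [[x [Mx x0]]|no] := pselect (exists x, M *m x = 0 /\ (ev x)`_0 != 0).
    have := @sdim_lead_lt i x (ltn_trans e0 ei) Mx x0; rewrite /gap; lia.
  have /k2 : forall x, M *m x = 0 -> (ev x)`_0 = 0.
    by move=> x Mx; apply/eqP; apply: contra_notT no => nz; exists x.
  rewrite /gap; lia.
- have := sdim_lead_col i; have := sdim_kerval_le1 i.-1 inj'; rewrite /gap; lia.
Qed.

End RankOneStep.

(** * Normal rank and polynomial solutions *)

Section PolynomialRank.
Variable F : fieldType.
Notation tofrac := (@FracField.tofrac {poly F}).
Notation K := {fraction {poly F}}.
Local Open Scope quotient_scope.

Lemma fraction_numden (x : K) : exists n d, d != 0 /\ tofrac d * x = tofrac n.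
Proof.
elim/quotW: x => r; exists (\n_r), (\d_r); split; first exact: denom_ratioP.
rewrite -[LHS]/(FracField.mul _ _) !piE; apply/eqmodP => /=.
rewrite FracField.equivfE /FracField.mulf !numden_Ratio ?mulf_neq0 ?oner_eq0 ?denom_ratioP//.
by rewrite mulr1 mul1r mulrC.
Qed.

Lemma clear_denominators n (y : 'cV[K]_n) :
  exists d (z : 'cV[{poly F}]_n), d != 0 /\ tofrac d *: y = map_mx tofrac z.
Proof.
have h i : exists nd : {poly F} * {poly F}, nd.2 != 0 /\ tofrac nd.2 * y i 0 = tofrac nd.1.
  by have [n' [d [d0 e]]] := fraction_numden (y i 0); exists (n', d).
pose nd i := projT1 (cid (h i)).
have nd0 i : (nd i).2 != 0 by have [] := projT2 (cid (h i)).
have ndE i : tofrac (nd i).2 * y i 0 = tofrac (nd i).1 by have [] := projT2 (cid (h i)).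
exists (\prod_i (nd i).2), (\col_i ((nd i).1 * \prod_(j | j != i) (nd j).2)).
split; first by apply/prodf_neq0.
apply/colP => i; rewrite !mxE (bigD1 i)//= !rmorphM/= -ndE.
by rewrite mulrAC.
Qed.

Lemma map_tofrac_eq0 m n (z : 'M[{poly F}]_(m, n)) : (map_mx tofrac z == 0) = (z == 0).
Proof.
apply/eqP/eqP => [e|->]; last by rewrite map_mx0.
by apply/matrixP => i j; have /matrixP/(_ i j)/eqP := e; rewrite !mxE tofrac_eq0 => /eqP.
Qed.

Definition prank m n (M : 'M[{poly F}]_(m, n)) : nat := \rank (map_mx tofrac M).

Lemma prank_full_inj m n (M : 'M[{poly F}]_(m, n)) (x : 'cV_n) :
  prank M = n -> M *m x = 0 -> x = 0.
Proof.
move=> rM /(congr1 (map_mx tofrac)); rewrite map_mxM map_mx0 => Mx.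
apply/eqP; rewrite -map_tofrac_eq0.
have /row_fullP[B BM] : row_full (map_mx tofrac M) by rewrite /row_full -/(prank M) rM.
by rewrite -[map_mx _ x]mul1mx -BM -mulmxA Mx mulmx0.
Qed.

(** Over the field of fractions, [phi] is in the row space of [M] exactly when it kills the cokernel
    columns, which span the kernel; clearing denominators makes such a column a polynomial
    solution. *)
Lemma escapesP p q (M : 'M[{poly F}]_(p, q)) (phi : 'rV_q) :
  escapes M phi <-> ~~ (map_mx tofrac phi <= map_mx tofrac M)%MS.
Proof.
split=> [[z [Mz]]|].
  apply: contra => /submxP[D phiD]; rewrite -tofrac_eq0.
  have -> : tofrac ((phi *m z) 0 0) = (map_mx tofrac phi *m map_mx tofrac z) 0 0.
    by rewrite -map_mxM [RHS]mxE.
  by rewrite phiD -mulmxA -map_mxM Mz map_mx0 mulmx0 mxE.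
rewrite submxE => /eqP nz.
set C := cokermx _ in nz.
have [c nzc] : exists c, map_mx tofrac phi *m col c C != 0.
  apply: contra_notP nz => h; apply/matrixP => i c; rewrite [RHS]mxE.
  transitivity (col c (map_mx tofrac phi *m C) i 0); first by rewrite [RHS]mxE.
  have /eqP e : map_mx tofrac phi *m col c C == 0 by apply: contra_notT h => h; exists c.
  by rewrite colE -mulmxA -colE e mxE.
have [d [z [d0 dz]]] := clear_denominators (col c C).
exists z; split.
  apply/eqP; rewrite -map_tofrac_eq0 map_mxM -dz -scalemxAr colE mulmxA mulmx_coker.
  by rewrite mul0mx scaler0.
apply: contra_neq nzc => /phi_eq0 e; apply/eqP.
have : tofrac d *: (map_mx tofrac phi *m col c C) == 0.
  by rewrite scalemxAr dz -map_mxM e map_mx0.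
by rewrite scaler_eq0 tofrac_eq0 (negPf d0).
Qed.

Lemma prank_col p q (M : 'M[{poly F}]_(p, q)) (phi : 'rV_q) :
  prank (col_mx M phi) = \rank (map_mx tofrac M + map_mx tofrac phi)%MS.
Proof. by rewrite /prank map_col_mx addsmxE. Qed.

Lemma prank_col_escapes p q (M : 'M[{poly F}]_(p, q)) (phi : 'rV_q) :
  escapes M phi -> prank (col_mx M phi) = (prank M).+1.
Proof.
move=> /escapesP nle; rewrite prank_col; apply/eqP; rewrite eqn_leq; apply/andP; split.
  apply: leq_trans (mxrank_adds_leqif _ _) _.
  by rewrite -[(prank M).+1]addn1 leq_add2l rank_leq_row.
rewrite ltn_neqAle mxrankS ?addsmxSl// andbT.
rewrite (mxrank_leqif_sup (addsmxSl _ _)).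
by apply: contra nle => h; apply: submx_trans (addsmxSr _ _) h.
Qed.

Lemma prank_col_not_escapes p q (M : 'M[{poly F}]_(p, q)) (phi : 'rV_q) :
  ~ escapes M phi -> prank (col_mx M phi) = prank M.
Proof.
move=> /escapesP/negP/negPn le; rewrite prank_col.
by have /addsmx_idPl-> := le.
Qed.

(** Adding [u *m phi] to the upper block is a row operation on the stacked matrix. *)
Lemma prank_col_perturb p q (M N : 'M[{poly F}]_(p, q)) u (phi : 'rV_q) :
  N = M + u *m phi -> prank (col_mx N phi) = prank (col_mx M phi).
Proof.
have sub (A B : 'M[{poly F}]_(p, q)) v :
  B = A + v *m phi -> (prank (col_mx B phi) <= prank (col_mx A phi))%N.
  move=> ->; rewrite !prank_col; apply: mxrankS.
  rewrite addsmx_sub addsmxSr andbT map_mxD map_mxM addmx_sub ?addsmxSl//.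
  by rewrite mulmx_sub ?addsmxSr.
move=> e; apply/eqP; rewrite eqn_leq (sub _ _ u)//= (sub _ _ (- u))//.
by rewrite e mulNmx addrK.
Qed.

End PolynomialRank.

(** * Rank through nonvanishing minors *)

Section MinorRank.
Variable K : fieldType.

(** Minors commute with ring morphisms, so they let the rank over the field of fractions be compared
    with the rank after evaluation. *)
Lemma rank_minor m n (A : 'M[K]_(m, n)) : exists f g, \det (mxsub f g A : 'M_(\rank A)) != 0.
Proof.
set f := maxrankfun A.
have full : row_full (rowsub f A)^T.
  by rewrite /row_full mxrank_tr; exact: maxrowsub_free.
have := fullrowsub_unit full; move: (fullrankfun full) => g gU.
exists f, g; rewrite -unitfE -unitmxE -unitmx_tr trmx_mxsub.
by move: gU; rewrite trmx_mxsub -mxsub_comp.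
Qed.

Lemma minor_rank m n r (A : 'M[K]_(m, n)) f g :
  \det (mxsub f g A : 'M_r) != 0 -> (r <= \rank A)%N.
Proof.
rewrite -unitfE -unitmxE => /mxrank_unit <-.
have -> : mxsub f g A = rowsub f (colsub g A) by rewrite -mxsub_comp.
apply: leq_trans (mxrankS (rowsub_sub _ _)) _.
by rewrite -mxrank_tr trmx_mxsub -[X in (_ <= X)%N]mxrank_tr mxrankS// rowsub_sub.
Qed.

End MinorRank.

(** * Invariance of the normal rank under moving [lam] to [0] *)

Section RankInvariance.
Variable F : closedFieldType.
Notation tofrac := (@FracField.tofrac {poly F}).

Lemma eval_pencil p q (A0 A1 : 'M[F]_(p, q)) (c : F) :
  A0 + c *: A1 = map_mx (horner_eval c) (pencil_poly A0 A1).
Proof.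
by apply/matrixP => i j; rewrite !mxE /horner_eval !hornerE mulrC.
Qed.

Lemma eval_rank_le p q (A0 A1 : 'M[F]_(p, q)) (c : F) :
  (\rank (A0 + c *: A1)%R <= nrank A0 A1)%N.
Proof.
rewrite eval_pencil; have [f [g]] := rank_minor (map_mx (horner_eval c) (pencil_poly A0 A1)).
rewrite -map_mxsub det_map_mx /= => nz; apply: (@minor_rank _ _ _ _ _ f g).
rewrite -map_mxsub det_map_mx /= tofrac_eq0; apply: contraNneq nz => ->.
by rewrite /horner_eval horner0.
Qed.

Lemma eval_rank_ge p q (A0 A1 : 'M[F]_(p, q)) :
  exists2 c : F, c != 0 & (nrank A0 A1 <= \rank (A0 + c *: A1)%R)%N.
Proof.
have [f [g]] := rank_minor (map_mx tofrac (pencil_poly A0 A1)).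
rewrite -map_mxsub det_map_mx /= tofrac_eq0 => nz.
set D := \det _ in nz.
(* The factor ['X] makes the chosen point nonzero, so that it can be inverted when [lam] is
   infinity. *)
have /closed_nonrootP[c] : D * 'X != 0 by rewrite mulf_neq0 ?polyX_eq0.
rewrite rootM negb_or rootX => /andP[Dc c0]; exists c => //.
rewrite eval_pencil; apply: (@minor_rank _ _ _ _ _ f g).
by rewrite -map_mxsub det_map_mx.
Qed.

(** The normal rank is the largest rank of a value of the pencil, attained at a nonzero point; at
    such points the values of either pencil are nonzero multiples of values of the other. *)
Lemma prank_trM p q lam (A0 A1 : 'M[F]_(p, q)) : prank (trM lam A0 A1) = nrank A0 A1.
Proof.
rewrite -[LHS]/(nrank _ _).
have [c c0 hc] := eval_rank_ge A0 A1.
have [d d0 hd] := eval_rank_ge (trE lam A0 A1) (trH lam A0 A1).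
apply/eqP; rewrite eqn_leq; apply/andP; split.
  apply: (leq_trans hd); case: lam {hd} => [l|] /=.
    by rewrite -addrA -scalerDl eval_rank_le.
  have -> : A1 + d *: A0 = d *: (A0 + d^-1 *: A1).
    by rewrite scalerDr scalerA divff// scale1r addrC.
  by rewrite mxrank_scale_nz// eval_rank_le.
apply: (leq_trans hc); case: lam {hd} => [l|] /=.
  have -> : A0 + c *: A1 = A0 + l *: A1 + (c - l) *: A1.
    by rewrite -addrA -scalerDl [l + _]addrC subrK.
  exact: eval_rank_le.
have -> : A0 + c *: A1 = c *: (A1 + c^-1 *: A0).
  by rewrite scalerDr scalerA divff// scale1r addrC.
by rewrite mxrank_scale_nz// eval_rank_le.
Qed.

End RankInvariance.

(** * Factorization of pencils of normal rank one *)

Section RankOneFactorization.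
Variable F : fieldType.

Lemma minors_factor m n (A : 'M[F]_(m, n)) :
  (forall i j k l, A i j * A k l = A i l * A k j) ->
  exists (u : 'cV_m) (v : 'rV_n), A = u *m v.
Proof.
move=> minors.
have [[i [j nz]]|z] := pselect (exists i j, A i j != 0); last first.
  exists 0, 0; rewrite mul0mx; apply/matrixP => i j; rewrite mxE; apply/eqP.
  by apply: contra_notT z => nz; exists i, j.
exists (col j A), ((A i j)^-1 *: row i A); apply/matrixP => k l.
rewrite !mxE big_ord1 !mxE mulrCA -(mulrC (A i l)) -minors mulrA mulVf// mul1r.
by [].
Qed.

Lemma nrank1_minors p q (P0 P1 : 'M[F]_(p, q)) (P := pencil_poly P0 P1) :
  nrank P0 P1 = 1%N -> forall i j k l, P i j * P k l = P i l * P k j.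
Proof.
rewrite /nrank -/P => r1 i j k l.
have := mulmx_base (map_mx (@FracField.tofrac _) P).
move: (col_base _) (row_base _); rewrite r1 => C R CR.
apply/eqP; rewrite -tofrac_eq !rmorphM /=.
have PE a b : @FracField.tofrac _ (P a b) = C a 0 * R 0 b.
  by have /matrixP/(_ a b) := CR; rewrite !mxE big_ord1.
by rewrite !PE mulrACA [R 0 j * _]mulrC mulrACA.
Qed.

(** The coefficients of degree [0] and [2] of the 2x2 minors factor [P0] and [P1] separately. The
    coefficient of degree [1] then is a minor of the two columns times a minor of the two rows, so
    the columns or the rows are multiples of one vector. *)
Lemma nrank1_split p q (P0 P1 : 'M[F]_(p, q)) : nrank P0 P1 = 1%N ->
  (exists (u0 u1 : 'cV_p) (v : 'rV_q), P0 = u0 *m v /\ P1 = u1 *m v) \/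
  (exists (u : 'cV_p) (v0 v1 : 'rV_q), P0 = u *m v0 /\ P1 = u *m v1).
Proof.
move=> /nrank1_minors minors.
have cf_minors n i j k l : (pencil_poly P0 P1 i j * pencil_poly P0 P1 k l)`_n =
    (pencil_poly P0 P1 i l * pencil_poly P0 P1 k j)`_n by rewrite minors.
have coefsE a b c d : [/\ ((a%:P + b%:P * 'X) * (c%:P + d%:P * 'X))`_0 = a * c,
    ((a%:P + b%:P * 'X) * (c%:P + d%:P * 'X))`_1 = a * d + b * c &
    ((a%:P + b%:P * 'X) * (c%:P + d%:P * 'X))`_2 = b * d :> F].
  have -> : (a%:P + b%:P * 'X) * (c%:P + d%:P * 'X) =
            (a * c)%:P + (a * d + b * c)%:P * 'X + (b * d)%:P * 'X^2 :> {poly F}.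
    by rewrite !(polyCM, polyCD); ring.
  by split; rewrite !(coefD, coefCM, coefX, coefXn, coefC) /=; ring.
have [u0 [v0 e0]] : exists (u : 'cV_p) (v : 'rV_q), P0 = u *m v.
  apply: minors_factor => i j k l; have := cf_minors 0%N i j k l; rewrite !mxE.
  have [-> _ _] := coefsE (P0 i j) (P1 i j) (P0 k l) (P1 k l).
  by have [-> _ _] := coefsE (P0 i l) (P1 i l) (P0 k j) (P1 k j).
have [u1 [v1 e1]] : exists (u : 'cV_p) (v : 'rV_q), P1 = u *m v.
  apply: minors_factor => i j k l; have := cf_minors 2%N i j k l; rewrite !mxE.
  have [_ _ ->] := coefsE (P0 i j) (P1 i j) (P0 k l) (P1 k l).
  by have [_ _ ->] := coefsE (P0 i l) (P1 i l) (P0 k j) (P1 k j).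
have P0E i j : P0 i j = u0 i 0 * v0 0 j by rewrite e0 mxE big_ord1.
have P1E i j : P1 i j = u1 i 0 * v1 0 j by rewrite e1 mxE big_ord1.
have cross i j k l :
    (u0 i 0 * u1 k 0 - u1 i 0 * u0 k 0) * (v0 0 j * v1 0 l - v1 0 j * v0 0 l) = 0.
  have := cf_minors 1%N i j k l; rewrite !mxE.
  have [_ -> _] := coefsE (P0 i j) (P1 i j) (P0 k l) (P1 k l).
  have [_ -> _] := coefsE (P0 i l) (P1 i l) (P0 k j) (P1 k j).
  by rewrite !P0E !P1E => e; rewrite -[RHS](subrr (P0 i j * P1 k l + P1 i j * P0 k l))
       !P0E !P1E {2}e; ring.
have [[i [k unz]]|upar] := pselect (exists i k, u0 i 0 * u1 k 0 - u1 i 0 * u0 k 0 != 0).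
  (* Stacking lets [minors_factor] produce the common row [v] even if [v0] or [v1] is zero. *)
  left; pose V := col_mx v0 v1.
  have [u [v Ve]] : exists (u : 'cV_(1 + 1)) (v : 'rV_q), V = u *m v.
    apply: minors_factor => a j b l.
    have vm j' l' : v0 0 j' * v1 0 l' = v1 0 j' * v0 0 l'.
      have /eqP := cross i j' k l'; rewrite mulf_eq0 (negPf unz) /= subr_eq0.
      by move/eqP.
    have V0 c : V (lshift 1 0) c = v0 0 c by rewrite col_mxEu.
    have V1 c : V (rshift 1 0) c = v1 0 c by rewrite col_mxEd.
    case: (split_ordP a) => a' ->; case: (split_ordP b) => b' ->; rewrite !ord1 ?V0 ?V1.
    - exact: mulrC.
    - by rewrite vm mulrC.
    - by rewrite -vm mulrC.
    - exact: mulrC.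
  have {}V0 : v0 = u (lshift 1 (0 : 'I_1)) 0 *: v.
    apply/rowP => c; have /matrixP/(_ (lshift 1 0) c) := Ve.
    by rewrite col_mxEu => ->; rewrite !mxE big_ord1.
  have {}V1 : v1 = u (rshift 1 (0 : 'I_1)) 0 *: v.
    apply/rowP => c; have /matrixP/(_ (rshift 1 0) c) := Ve.
    by rewrite col_mxEd => ->; rewrite !mxE big_ord1.
  exists (u (lshift 1 (0 : 'I_1)) 0 *: u0), (u (rshift 1 (0 : 'I_1)) 0 *: u1), v.
  by rewrite -!scalemxAl !scalemxAr -V0 -V1.
right; pose U := row_mx u0 u1.
have um i' k' : u0 i' 0 * u1 k' 0 = u1 i' 0 * u0 k' 0.
  apply/eqP; rewrite -subr_eq0; apply: contra_notT upar => nz.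
  by exists i', k'.
have [u [v Ue]] : exists (u : 'cV_p) (v : 'rV_(1 + 1)), U = u *m v.
  apply: minors_factor => i a k b.
  have U0 c : U c (lshift 1 0) = u0 c 0 by rewrite row_mxEl.
  have U1 c : U c (rshift 1 0) = u1 c 0 by rewrite row_mxEr.
  case: (split_ordP a) => a' ->; case: (split_ordP b) => b' ->; rewrite !ord1 ?U0 ?U1 ?um//.
have U0 : u0 = v 0 (lshift 1 (0 : 'I_1)) *: u.
  apply/colP => c; have /matrixP/(_ c (lshift 1 0)) := Ue.
  by rewrite row_mxEl => ->; rewrite !mxE big_ord1 mulrC.
have U1 : u1 = v 0 (rshift 1 (0 : 'I_1)) *: u.
  apply/colP => c; have /matrixP/(_ c (rshift 1 0)) := Ue.
  by rewrite row_mxEr => ->; rewrite !mxE big_ord1 mulrC.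
exists u, (v 0 (lshift 1 (0 : 'I_1)) *: v0), (v 0 (rshift 1 (0 : 'I_1)) *: v1).
by rewrite -!scalemxAr !scalemxAl -U0 -U1.
Qed.

Lemma pencil_polyMl p q (u0 u1 : 'cV[F]_p) (v : 'rV_q) :
  pencil_poly (u0 *m v) (u1 *m v) = pencil_poly u0 u1 *m map_mx polyC v.
Proof. by rewrite !pencil_polyE !map_mxM mulmxDl scalemxAl. Qed.

Lemma pencil_polyMr p q (u : 'cV[F]_p) (v0 v1 : 'rV_q) :
  pencil_poly (u *m v0) (u *m v1) = map_mx polyC u *m pencil_poly v0 v1.
Proof. by rewrite !pencil_polyE !map_mxM mulmxDr scalemxAr. Qed.

(** The variable occurs in one factor only, and moving [lam] acts on that factor alone, so [phi] is
    constant or of degree at most one. *)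
Lemma trM_factor p q lam (P0 P1 : 'M[F]_(p, q)) : nrank P0 P1 = 1%N ->
  exists (u : 'cV_p) (phi : 'rV_q),
    trM lam P0 P1 = u *m phi /\ forall c, (size (phi 0%R c) <= 2)%N.
Proof.
case/nrank1_split => [[u0 [u1 [v [-> ->]]]]|[u [v0 [v1 [-> ->]]]]].
  exists (trM lam u0 u1), (map_mx polyC v); split.
    rewrite -pencil_polyMl /trM; congr pencil_poly; case: lam => [l|] //=.
    by rewrite mulmxDl scalemxAl.
  by move=> c; rewrite mxE (leq_trans (size_polyC_leq1 _)).
exists (map_mx polyC u), (trM lam v0 v1); split.
  rewrite -pencil_polyMr /trM; congr pencil_poly; case: lam => [l|] //=.
  by rewrite mulmxDr scalemxAr.
move=> c; rewrite mxE; apply: (leq_trans (size_polyD _ _)).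
rewrite geq_max (leq_trans (size_polyC_leq1 _))//=.
by apply: (@size_mul_le _ _ _ 1 2); rewrite ?size_polyC_leq1 ?size_polyX.
Qed.

Lemma trM_add p q lam (A0 A1 P0 P1 : 'M[F]_(p, q)) :
  trM lam (A0 + P0) (A1 + P1) = trM lam A0 A1 + trM lam P0 P1.
Proof.
rewrite /trM !pencil_polyE addrACA -scalerDr -!map_mxD.
by case: lam => [l|] //=; rewrite scalerDr addrACA.
Qed.

End RankOneFactorization.

(** * The dimension of Z_d read off the Kronecker form *)

Section KroneckerForm.
Variable F : fieldType.

Lemma lin_rel_bij (uT vT : vectType F) (R : uT -> vT -> Prop) : lin_rel R ->
  (forall y, R 0 y -> y = 0) -> (forall x, R x 0 -> x = 0) ->
  sdim (fun x => exists y, R x y) = sdim (fun y => exists x, R x y).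
Proof.
move=> Rlin y0 x0; have [R00 _] := Rlin.
have := lin_rel_dim Rlin.
rewrite (@sdim0 _ _ (fun y => R 0 y)); last by move=> v; split=> [/y0|->].
rewrite (@sdim0 _ _ (fun x => R x 0)); last by move=> v; split=> [/x0|->].
by rewrite !addn0.
Qed.

Lemma vsizeCM m n (A : 'M[F]_(m, n)) (x : 'cV_n) d :
  vsize x d -> vsize (map_mx polyC A *m x) d.
Proof. by move=> /vsizeP h; apply/vsizeP => j /h e; rewrite cfCM e mulmx0. Qed.

(** Constant factors do not raise degrees: [Q] carries solutions for the product to solutions for
    [M], and [invmx Q] carries them back. *)
Lemma sdim_kerval_equiv p q (M : 'M[{poly F}]_(p, q)) (P : 'M[F]_p) (Q : 'M[F]_q) d :
  P \in unitmx -> Q \in unitmx ->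
  sdim (kerval (map_mx polyC P *m M *m map_mx polyC Q) d) = sdim (kerval M d).
Proof.
move=> Pu Qu; set N := _ *m _ *m _.
pose R (v w : 'cV[F]_q) := kerval N d v /\ w = Q *m v.
have Rlin : lin_rel R.
  have [N0 NL] := kerval_lin N d; split; first by split; rewrite ?mulmx0.
  move=> a x y x' y' [h ->] [h' ->]; split; first exact: NL.
  by rewrite mulmxDr -scalemxAr.
have QK m (x : 'M[{poly F}]_(q, m)) : map_mx polyC Q *m (map_mx polyC (invmx Q) *m x) = x.
  by rewrite mulmxA -map_mxM mulmxV// map_mx1 mul1mx.
have PK m (x : 'M[{poly F}]_(p, m)) : map_mx polyC (invmx P) *m (map_mx polyC P *m x) = x.
  by rewrite mulmxA -map_mxM mulVmx// map_mx1 mul1mx.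
rewrite (@eq_sdim _ _ (kerval N d) (fun v => exists w, R v w)); last first.
  by move=> v; split=> [h|[w []//]]; exists (Q *m v).
rewrite (lin_rel_bij Rlin); last 2 first.
- by move=> y [_ ->]; rewrite mulmx0.
- by move=> x [_ /(congr1 (mulmx (invmx Q)))]; rewrite mulmx0 mulKmx.
apply: eq_sdim => w; split=> [[v [[x [Nx sx <-]] ->]]|[x [Mx sx <-]]].
  exists (map_mx polyC Q *m x); split; [|exact: vsizeCM|by rewrite cfCM].
  by rewrite -[LHS]PK [X in _ *m X](_ : _ = N *m x) ?Nx ?mulmx0 // /N !mulmxA.
exists (invmx Q *m cf 0 x); split; last by rewrite mulKVmx.
exists (map_mx polyC (invmx Q) *m x); split; [|exact: vsizeCM|by rewrite cfCM].
by rewrite /N -!mulmxA QK Mx mulmx0.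
Qed.

Lemma cf_col_mx m1 m2 n j (x : 'M[{poly F}]_(m1, n)) (y : 'M_(m2, n)) :
  cf j (col_mx x y) = col_mx (cf j x) (cf j y).
Proof. exact: map_col_mx. Qed.

Lemma vsize_col m1 m2 (x : 'cV[{poly F}]_m1) (y : 'cV_m2) d :
  vsize (col_mx x y) d <-> vsize x d /\ vsize y d.
Proof.
split=> [h|[hx hy] r].
  split=> r; first by have := h (lshift _ r); rewrite col_mxEu.
  by have := h (rshift _ r); rewrite col_mxEd.
by case: (split_ordP r) => r' ->; rewrite ?col_mxEu ?col_mxEd.
Qed.

Lemma kerval_block p1 p2 q1 q2 (M : 'M[{poly F}]_(p1, q1)) (N : 'M_(p2, q2)) d v w :
  kerval (block_mx M 0 0 N) d (col_mx v w) <-> kerval M d v /\ kerval N d w.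
Proof.
split=> [[x]|[[x [Mx sx <-]] [y [Ny sy <-]]]]; last first.
  exists (col_mx x y); rewrite mul_block_col !mul0mx addr0 add0r Mx Ny col_mx0 cf_col_mx.
  by split=> //; apply/vsize_col.
rewrite -[x]vsubmxK mul_block_col !mul0mx addr0 add0r cf_col_mx.
move=> [/eqP]; rewrite col_mx_eq0 => /andP[/eqP Mx /eqP Nx] /vsize_col[sx sy].
move=> /eq_col_mx[ex ey].
by split; eexists; split; eauto.
Qed.

(** Projection to the upper part has image [kerval M d], and it kills exactly the vectors
    [col_mx 0 v] with [v] in [kerval N d]. *)
Lemma sdim_kerval_block p1 p2 q1 q2 (M : 'M[{poly F}]_(p1, q1)) (N : 'M_(p2, q2)) d :
  sdim (kerval (block_mx M 0 0 N) d) = (sdim (kerval M d) + sdim (kerval N d))%N.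
Proof.
set B := block_mx _ _ _ _.
have [B0 BL] := kerval_lin B d.
pose R (w : 'cV[F]_(q1 + q2)) (v : 'cV[F]_q1) := kerval B d w /\ v = usubmx w.
have Rlin : lin_rel R.
  split; first by split=> //; rewrite linear0.
  by move=> a x y x' y' [h ->] [h' ->]; split; [exact: BL | rewrite linearP].
have := lin_rel_dim Rlin.
rewrite (@sdim0 _ _ (fun y => R 0 y)); last first.
  by move=> v; split=> [[_ ->]|->]; rewrite ?linear0//; split; rewrite ?linear0.
rewrite (@eq_sdim _ _ (fun v => exists w, R v w) (kerval B d)); last first.
  by move=> v; split=> [[w []//]|h]; exists (usubmx v).
have N0 : kerval N d 0 by have [] := kerval_lin N d.
have M0 : kerval M d 0 by have [] := kerval_lin M d.
rewrite (@eq_sdim _ _ (fun w => exists v, R v w) (kerval M d)); last first.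
  move=> v; split=> [[w [h ->]]|h].
    by move: h; rewrite -{1}[w]vsubmxK => /kerval_block[].
  by exists (col_mx v 0); split; [apply/kerval_block | rewrite col_mxKu].
rewrite addn0 => ->; congr addn.
pose S (w : 'cV[F]_(q1 + q2)) (v : 'cV[F]_q2) := kerval N d v /\ w = col_mx 0 v.
have Slin : lin_rel S.
  split; first by split; rewrite ?col_mx0.
  move=> a x y x' y' [h ->] [h' ->]; split.
    by have [_ L] := kerval_lin N d; exact: L.
  by rewrite scale_col_mx add_col_mx scaler0 addr0.
transitivity (sdim (fun w => exists v, S w v)).
  apply: eq_sdim => w; split=> [[h u0]|[v [h ->]]]; last first.
    by split; [apply/kerval_block | rewrite col_mxKu].
  have wE : w = col_mx 0 (dsubmx w) by rewrite -{1}[w]vsubmxK -u0.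
  by exists (dsubmx w); split=> //; move: h; rewrite {1}wE => /kerval_block[].
rewrite (lin_rel_bij Slin).
- by apply: eq_sdim => v; split=> [[w []//]|h]; exists (col_mx 0 v).
- by move=> y [_ /esym/eqP]; rewrite col_mx_eq0 => /andP[_ /eqP].
- by move=> x [_ ->]; rewrite col_mx0.
Qed.

Lemma trM_block p1 p2 q1 q2 lam (A0 A1 : 'M[F]_(p1, q1)) (B0 B1 : 'M_(p2, q2)) :
  trM lam (block_mx A0 0 0 B0) (block_mx A1 0 0 B1) =
  block_mx (trM lam A0 A1) 0 0 (trM lam B0 B1).
Proof.
rewrite /trM !pencil_polyE; case: lam => [l|] /=;
by rewrite ?scale_block_mx ?add_block_mx ?map_block_mx ?scale_block_mx ?add_block_mx
  ?scaler0 ?addr0 ?map_mx0 ?scaler0 ?addr0.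
Qed.

(** The dimensions are the sums of the block sizes themselves, which permits induction on [bs]. *)
Definition kmx c (bs : seq (kblock F)) : 'M[F]_(sumn (map (@rdim F) bs), sumn (map (@cdim F) bs)) :=
  \matrix_(i, j) kcf_entry c bs i j.
Definition bmx0 (b : kblock F) : 'M[F]_(rdim b, cdim b) := \matrix_(i, j) blk0 b i j.
Definition bmx1 (b : kblock F) : 'M[F]_(rdim b, cdim b) := \matrix_(i, j) blk1 b i j.

Lemma kmx_cons c b bs :
  kmx c (b :: bs) = block_mx (if c then bmx1 b else bmx0 b) 0 0 (kmx c bs).
Proof.
apply/matrixP => i j; rewrite mxE /kcf_entry /= big_ord_recl /= !add0n !subn0.
have tailE i' j' : \sum_(t < size bs)
    (let b0 := nth (KN F 0) bs t in
     let ro := (rdim b + sumn (map (@rdim F) (take t bs)))%N in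
     let co := (cdim b + sumn (map (@cdim F) (take t bs)))%N in
     if ((ro <= i' < ro + rdim b0) && (co <= j' < co + cdim b0))%N
     then (if c then blk1 b0 (i' - ro) (j' - co) else blk0 b0 (i' - ro) (j' - co)) else 0) =
    if ((rdim b <= i') && (cdim b <= j'))%N
    then kcf_entry c bs (i' - rdim b) (j' - cdim b) else 0.
  case: ifP => [/andP[hi hj]|h].
    apply: eq_bigr => t _ /=; rewrite !subnDA; congr (if _ then _ else _); lia.
  by apply: big1 => t _ /=; case: ifP => // h'; move: h; lia.
rewrite tailE.
case: (split_ordP i) => i' ->; case: (split_ordP j) => j' -> /=.
- rewrite block_mxEul [(rdim b <= i')%N]leqNgt ltn_ord /= addr0.
  by case: c {tailE}; rewrite mxE.
- by rewrite block_mxEur mxE [(rdim b <= i')%N]leqNgt ltn_ord /= addr0.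
- by rewrite block_mxEdl mxE [(cdim b <= j')%N]leqNgt ltn_ord andbF addr0.
- by rewrite block_mxEdr mxE !leq_addr /= !addKn add0r.
Qed.

(** Homogeneous coordinates of the moved variable, treating finite and infinite [lam] alike. *)
Definition hom0 (lam : option F) : {poly F} := if lam is Some _ then 1 else 'X.
Definition hom1 (lam : option F) : {poly F} := if lam is Some l then 'X + l%:P else 1.

Lemma trM_hom p q lam (A0 A1 : 'M[F]_(p, q)) :
  trM lam A0 A1 = hom0 lam *: map_mx polyC A0 + hom1 lam *: map_mx polyC A1.
Proof.
rewrite /trM pencil_polyE; case: lam => [l|] /=.
  by rewrite scale1r map_mxD map_mxZ scalerDl addrAC -addrA.
by rewrite scale1r addrC.
Qed.

(** Padding by zeros makes the row formula of a block valid in its last row. *)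
Definition entry q (x : 'cV[{poly F}]_q) (k : nat) : {poly F} :=
  if insub k is Some i then x i 0 else 0.

Lemma entry_ord q (x : 'cV[{poly F}]_q) (i : 'I_q) : entry x i = x i 0.
Proof. by rewrite /entry valK. Qed.

Lemma entry_out q (x : 'cV[{poly F}]_q) k : (q <= k)%N -> entry x k = 0.
Proof. by move=> qk; rewrite /entry insubN// -leqNgt. Qed.

Lemma sum_entry q (x : 'cV[{poly F}]_q) (k : nat) :
  \sum_(j < q) ((k == j)%:R : F)%:P * x j 0 = entry x k.
Proof.
have [qk|kq] := leqP q k.
  by rewrite entry_out// big1// => j _; case: eqP => [e|_]; rewrite ?mul0r//; have := ltn_ord j; lia.
rewrite (bigD1 (Ordinal kq))//= eqxx mul1r big1 ?addr0 -?(entry_ord x (Ordinal kq))//.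
by move=> j ij; case: eqP => [e|_]; rewrite ?mul0r//; case/eqP: ij; apply/val_inj.
Qed.

Definition blk_row (b : kblock F) (X0 X1 : {poly F}) (x : nat -> {poly F}) (i : nat) :=
  match b with
  | KL _ => X0 * x i.+1 + X1 * x i
  | KLt _ => X0 * (if i is i'.+1 then x i' else 0) + X1 * x i
  | KJ l _ => X0 * (x i.+1 - l%:P * x i) + X1 * x i
  | KN _ => X0 * x i + X1 * x i.+1
  end.

Lemma trM_blk lam b (x : 'cV_(cdim b)) (i : 'I_(rdim b)) :
  (trM lam (bmx0 b) (bmx1 b) *m x) i 0 = blk_row b (hom0 lam) (hom1 lam) (entry x) i.
Proof.
rewrite trM_hom mulmxDl -!scalemxAl [LHS]mxE [X in X + _]mxE [X in _ + X]mxE.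
have sum_rev (k : nat) : \sum_(j < cdim b) ((nat_of_ord j == k)%:R : F)%:P * x j 0 = entry x k.
  by rewrite -sum_entry; apply: eq_bigr => j _; rewrite eq_sym.
have sum_lo (k : nat) : \sum_(j < cdim b) ((k == j.+1)%:R : F)%:P * x j 0 =
    if k is k'.+1 then entry x k' else 0.
  case: k => [|k]; last exact: sum_entry.
  by apply: big1 => j _; rewrite mul0r.
case: b x i sum_rev sum_lo => [k|k|l k|k] x i sum_rev sum_lo; congr (_ * _ + _ * _);
  rewrite mxE; under eq_bigr do rewrite !mxE /=; rewrite ?sum_entry ?sum_rev ?sum_lo//.
under eq_bigr do rewrite polyCD polyCN polyCM mulrDl addrC.
rewrite big_split /= sum_rev; congr (_ + _).
by rewrite -sum_entry mulr_sumr -sumrN; apply: eq_bigr => j _; rewrite mulNr mulrA [_ * l%:P]mulrC.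
Qed.

(** Descending induction: entries past the end are zero, and [c != 0] passes this down to smaller
    indices. *)
Lemma entry_eq0 q (x : 'cV[{poly F}]_q) (c e : {poly F}) : c != 0 ->
  (forall i, (i < q)%N -> c * entry x i + e * entry x i.+1 = 0) -> x = 0.
Proof.
move=> c0 h; have {}h m : forall i, (q <= m + i)%N -> entry x i = 0.
  elim: m => [|m IH] i; first exact: entry_out.
  have [qi _|iq hm] := leqP q i; first exact: entry_out.
  have := h i iq; rewrite (IH i.+1); last by rewrite -addSnnS.
  by rewrite mulr0 addr0 => /eqP; rewrite mulf_eq0 (negPf c0) => /eqP.
by apply/colP => i; rewrite mxE -entry_ord (h q)// leq_addr.
Qed.

Lemma sdim_kerval0 p q (M : 'M[{poly F}]_(p, q)) d :
  (forall x : 'cV_q, M *m x = 0 -> x = 0) -> sdim (kerval M d) = 0%N.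
Proof.
move=> inj; apply: sdim0 => v; split=> [[x [/inj-> _ <-]]|->]; first exact: cf0.
by have [] := kerval_lin M d.
Qed.

(** For [d <= k] a nonzero multiple of [w] has too large a degree in row [r0]; for [k < d] the
    constant terms fill the line of [cf 0 w], nonzero by row [r1]. *)
Lemma sdim_kerval_line p q (M : 'M[{poly F}]_(p, q)) (w : 'cV_q) k d r0 r1 :
  M *m w = 0 -> (forall x : 'cV_q, M *m x = 0 -> exists g, x = g *: w) ->
  vsize w k.+1 -> size (w r0 0%R) = k.+1 -> w r1 0 = 1 ->
  sdim (kerval M d) = (k < d)%N.
Proof.
move=> Mw kerM sw sr0 wr1; case: ltnP => [kd|dk].
  have w0 : cf 0 w != 0.
    apply/eqP => /colP/(_ r1); rewrite cfE wr1 mxE coef1 => /eqP.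
    by rewrite oner_eq0.
  rewrite (@sdimE _ _ _ <[cf 0 w]>%VS); first by rewrite dim_vline w0.
  move=> v; split=> [/vlineP[c ->]|[x [/kerM[g ->] _ <-]]].
    have [_ L] := kerval_lin M d; rewrite -[_ *: _]addr0; apply: L.
      by exists w; split=> // r; apply: leq_trans (sw r) kd.
    by have [] := kerval_lin M d.
  apply/vlineP; exists g`_0; apply/colP => r.
  by rewrite cfE [(g *: w) r 0]mxE [RHS]mxE cfE coef0M.
apply: sdim0 => v; split=> [[x [/kerM[g ->] sx <-]]|->]; last by have [] := kerval_lin M d.
have [->|g0] := eqVneq g 0; first by rewrite scale0r cf0.
have w0 : w r0 0 != 0 by rewrite -size_poly_eq0 sr0.
have := sx r0; rewrite mxE size_mul// sr0 addnS /= => h.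
have : (0 < size g)%N by rewrite size_poly_gt0.
by have := leq_trans h dk; rewrite -[X in (_ <= X)%N -> _]add0n leq_add2r leqNgt => /negPf->.
Qed.

Lemma size_expl (p : {poly F}) n : size p = 2 -> size (p ^+ n) = n.+1.
Proof.
move=> sp; have := size_exp p n; rewrite sp mul1n.
have : p ^+ n != 0 by rewrite expf_neq0// -size_poly_eq0 sp.
by rewrite -size_poly_eq0; case: (size _) => //= m _ ->.
Qed.

(** All blocks but [KL] give recursions that force every entry to be zero. For [KL k] the solutions
    are the multiples of a vector of powers of one polynomial [t] of degree one. *)
Lemma sdim_kerval_blk lam b d :
  sdim (kerval (trM lam (bmx0 b) (bmx1 b)) d) = (if b is KL k then (k < d)%N : nat else 0%N).
Proof.
have rowP (x : 'cV_(cdim b)) : trM lam (bmx0 b) (bmx1 b) *m x = 0 <->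
    forall i, (i < rdim b)%N -> blk_row b (hom0 lam) (hom1 lam) (entry x) i = 0.
  split=> [h i ir|h]; first by rewrite -(trM_blk lam x (Ordinal ir)) h mxE.
  by apply/colP => i; rewrite trM_blk h// mxE.
have h0 : hom0 lam != 0 by case: lam {rowP} => [l|] /=; rewrite ?oner_eq0 ?polyX_eq0.
case: b rowP => [k|k|l k|k] rowP; last 3 first.
- apply: sdim_kerval0 => x /rowP h.
  apply: (entry_eq0 (e := hom1 lam) h0) => i ik.
  by have := h i.+1 ik.
- apply: sdim_kerval0 => x /rowP h.
  apply: (@entry_eq0 _ _ (hom1 lam - l%:P * hom0 lam) (hom0 lam)) => [|i ik].
    (* The leading coefficient is ['X + l' - l] at a finite point and [1 - l * 'X] at infinity. *)
    case: lam {rowP h0 h} => [l'|] /=; apply/eqP => /polyP.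
      by move/(_ 1%N); rewrite !(coefD, coefN, coefCM, coefX, coefC, coef0, coef1) /= => /eqP;
         rewrite mulr0 subr0 addr0 oner_eq0.
    by move/(_ 0%N); rewrite !(coefD, coefN, coefCM, coefX, coefC, coef0, coef1) /= => /eqP;
         rewrite mulr0 subr0 oner_eq0.
  by rewrite -[RHS](h i ik) /=; ring.
- apply: sdim_kerval0 => x /rowP h.
  apply: (entry_eq0 (e := hom1 lam) h0) => i ik.
  by have := h i ik.
case: lam rowP h0 => [l|] rowP _ /=.
  pose t : {poly F} := - ('X + l%:P).
  have st : size t = 2 by rewrite size_polyN -[l]opprK polyCN size_XsubC.
  pose w : 'cV[{poly F}]_k.+1 := \col_(j < k.+1) t ^+ j.
  have ew j : (j < k.+1)%N -> entry w j = t ^+ j.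
    by move=> jk; rewrite -[j]/(nat_of_ord (Ordinal jk)) entry_ord mxE.
  apply: (@sdim_kerval_line _ _ _ w k d ord_max ord0).
  - apply/rowP => i ik; rewrite /= !ew//; last by rewrite leqW.
    by rewrite exprS /t; ring.
  - move=> x /rowP h; exists (entry x 0); apply/colP => j; rewrite !mxE -entry_ord.
    case: j => j /=; elim: j => [|j IH] jk; first by rewrite mulr1.
    have := h j jk; rewrite /= mul1r (IH (ltnW jk)) => /eqP; rewrite addr_eq0 => /eqP ->.
    by rewrite exprS /t; ring.
  - by move=> r; rewrite mxE size_expl.
  - by rewrite mxE size_expl.
  - by rewrite mxE expr0.
pose t : {poly F} := - 'X.
have st : size t = 2 by rewrite size_polyN size_polyX.
(* At infinity the recursion expresses each entry by the next one, so the powers run backwards. *)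
pose w : 'cV[{poly F}]_k.+1 := \col_(j < k.+1) t ^+ (k - j).
have ew j : (j < k.+1)%N -> entry w j = t ^+ (k - j).
  by move=> jk; rewrite -[j]/(nat_of_ord (Ordinal jk)) entry_ord mxE.
apply: (@sdim_kerval_line _ _ _ w k d ord0 ord_max).
- apply/rowP => i ik; rewrite /= !ew//; last by rewrite leqW.
  by rewrite -[(k - i)%N]prednK ?subn_gt0// exprS subnS /t; ring.
- move=> x /rowP h; exists (entry x k); apply/colP => j; rewrite !mxE -entry_ord.
  have : forall n, (n <= k)%N -> entry x (k - n) = entry x k * t ^+ n.
    elim=> [|n IH] nk; first by rewrite subn0 mulr1.
    have := h (k - n.+1)%N; rewrite /= -subSn// subSS IH ?(ltnW nk)// => /(_ _)/eqP.
    rewrite addrC addr_eq0 mul1r => /(_ _)/eqP ->; last by lia.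
    by rewrite exprS /t; ring.
  by move/(_ (k - j)%N (leq_subr _ _)); rewrite subKn// -ltnS.
- by move=> r; rewrite mxE size_expl// ltnS leq_subr.
- by rewrite mxE size_expl// subn0.
- by rewrite mxE subnn expr0.
Qed.

(** Equal column minimal indices enter the proof through this count: they give both pencils the same
    dim Z_d for every [d]. *)
Lemma sdim_kerval_kcf p q lam (A0 A1 : 'M[F]_(p, q)) bs d : is_kcf A0 A1 bs ->
  sdim (kerval (trM lam A0 A1) d) = count (fun k => k < d)%N (col_indices bs).
Proof.
move=> [_ ep eq [P [Q [Pu Qu e0 e1]]]]; subst p q.
have -> : sdim (kerval (trM lam A0 A1) d) = sdim (kerval (trM lam (kmx false bs) (kmx true bs)) d).
  rewrite /kmx -e0 -e1 -(sdim_kerval_equiv _ _ Pu Qu) !trM_hom !map_mxM.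
  by rewrite mulmxDr mulmxDl -!scalemxAr -!scalemxAl.
elim: bs {P Q Pu Qu e0 e1 A0 A1} => [|b bs IH].
  apply: sdim_kerval0 => x _; apply/colP => -[m /=]; by [].
rewrite !kmx_cons trM_block sdim_kerval_block IH sdim_kerval_blk.
by case: b.
Qed.

End KroneckerForm.

(** * Comparison of a pencil with its perturbation *)

Section Perturbation.
Variable F : fieldType.

Lemma lead_perturb p q (M N : 'M[{poly F}]_(p, q)) (u : 'cV_p) (phi : 'rV_q) i v :
  N = M + u *m phi -> lead (col_mx M phi) i v -> lead (col_mx N phi) i v.
Proof.
move=> -> [x [/[!mul_col_mx]/vanish_col[hM hphi] e]]; exists x; split=> //.
rewrite mul_col_mx; apply/vanish_col; split=> //.
rewrite mulmxDl; apply: vanishD => //; rewrite -mulmxA.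
by have [y ->] := hphi; exists (u *m y); rewrite scalemxAr.
Qed.

Lemma kerval_perturb p q (M N : 'M[{poly F}]_(p, q)) (u : 'cV_p) (phi : 'rV_q) d v :
  N = M + u *m phi -> kerval (col_mx M phi) d v -> kerval (col_mx N phi) d v.
Proof.
move=> -> [x [/ker_col[Mx ex] sx e]]; exists x; split=> //; apply/ker_col; split=> //.
by rewrite mulmxDl Mx -mulmxA (phi_eq0 _ _).2// mulmx0 addr0.
Qed.

(** The terms of the stacked matrices cancel, since adding [u *m phi] does not change the solutions
    on which [phi] vanishes to the required order. *)
Lemma weyr_perturb p q lam (A0 A1 B0 B1 : 'M[F]_(p, q)) (u : 'cV_p) (phi : 'rV_q) i :
  trM lam B0 B1 = trM lam A0 A1 + u *m phi -> (0 < i)%N ->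
  weyr B0 B1 lam i - weyr A0 A1 lam i =
  gap (trM lam B0 B1) phi i - gap (trM lam A0 A1) phi i.
Proof.
move=> e i0; rewrite !weyrE// /gap.
have e' : trM lam A0 A1 = trM lam B0 B1 + (- u) *m phi by rewrite e mulNmx addrK.
rewrite (@eq_sdim _ _ (lead (col_mx (trM lam B0 B1) phi) i)
  (lead (col_mx (trM lam A0 A1) phi) i)); last first.
  by move=> v; split; [exact: lead_perturb e' | exact: lead_perturb e].
rewrite (@eq_sdim _ _ (kerval (col_mx (trM lam B0 B1) phi) i.-1)
  (kerval (col_mx (trM lam A0 A1) phi) i.-1)); last first.
  by move=> v; split; [exact: kerval_perturb e' | exact: kerval_perturb e].
lia.
Qed.

Lemma lead_perturb_bound p q (M N : 'M[{poly F}]_(p, q)) (u : 'cV_p) (phi : 'rV_q) i :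
  N = M + u *m phi -> (sdim (lead N i) <= (sdim (lead M i)).+1)%N.
Proof.
move=> e; have e' : M = N + (- u) *m phi by rewrite e mulNmx addrK.
apply: leq_trans (sdim_lead_codim1 N phi i) _; rewrite ltnS.
rewrite (@eq_sdim _ _ (lead (col_mx N phi) i) (lead (col_mx M phi) i)).
  exact: sdim_lead_col.
by move=> v; split; [exact: lead_perturb e' | exact: lead_perturb e].
Qed.

End Perturbation.

(* A(s) = A0 + s A1, P(s) = P0 + s P1, A(s)+P(s) = (A0+P0) + s (A1+P1);
   lam = Some l is l in F, lam = None is infinity. *)
Theorem theorem5p4 (F : closedFieldType) (p q : nat)
  (A0 A1 P0 P1 : 'M[F]_(p, q)) (lam : option F) :
  nrank P0 P1 = 1%N ->
  let D i := weyr (A0 + P0) (A1 + P1) lam i - weyr A0 A1 lam i in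
  [/\
  (* (i) *)
  (regular A0 A1 -> regular (A0 + P0) (A1 + P1) ->
     forall i, (1 <= i)%N -> -1 <= D i <= 1),
  (* (ii) *)
  (regular A0 A1 -> ~ regular (A0 + P0) (A1 + P1) ->
     exists a : nat, (1 <= a)%N /\
       (forall i, (1 <= i <= a)%N -> -1 <= D i <= 1) /\
       (forall i, (a.+1 <= i)%N -> -2 <= D i <= 0)),
  (* (iii) *)
  (~ regular A0 A1 -> regular (A0 + P0) (A1 + P1) ->
     exists a : nat, (1 <= a)%N /\
       (forall i, (1 <= i <= a)%N -> -1 <= D i <= 1) /\
       (forall i, (a.+1 <= i)%N -> 0 <= D i <= 2)) &
  (* (iv) *)
  (~ regular A0 A1 -> ~ regular (A0 + P0) (A1 + P1) ->
     [/\
      (nrank A0 A1 = nrank (A0 + P0) (A1 + P1) ->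
        same_col_min_indices A0 A1 (A0 + P0) (A1 + P1) ->
        forall i, (1 <= i)%N -> -1 <= D i <= 1),
      (nrank A0 A1 = nrank (A0 + P0) (A1 + P1) ->
        ~ same_col_min_indices A0 A1 (A0 + P0) (A1 + P1) ->
        exists a b : nat, (1 <= a < b)%N /\
          (forall i, (1 <= i <= a)%N -> -1 <= D i <= 1) /\
          (forall i, (a.+1 <= i <= b)%N ->
             - (a.+1)%:Z <= D i <= (a.+1)%:Z) /\
          (forall i, (b.+1 <= i)%N -> - b%:Z <= D i <= b%:Z)),
      ((nrank A0 A1 < nrank (A0 + P0) (A1 + P1))%N ->
        exists a : nat, (1 <= a)%N /\
          (forall i, (1 <= i <= a)%N -> -1 <= D i <= 1) /\
          (forall i, (a.+1 <= i)%N -> 0 <= D i <= (a.+1)%:Z)) &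
      ((nrank (A0 + P0) (A1 + P1) < nrank A0 A1)%N ->
        exists a : nat, (1 <= a)%N /\
          (forall i, (1 <= i <= a)%N -> -1 <= D i <= 1) /\
          (forall i, (a.+1 <= i)%N -> - (a.+1)%:Z <= D i <= 0))])].
Proof.
move=> nP D; set B0 := A0 + P0; set B1 := A1 + P1.
have [u [phi [PE phi2]]] := trM_factor lam nP.
set MA := trM lam A0 A1; set MB := trM lam B0 B1.
have AB : MB = MA + u *m phi by rewrite /MB trM_add PE.
have BA : MA = MB + (- u) *m phi by rewrite AB mulNmx addrK.
have DE i : (0 < i)%N -> D i = gap MB phi i - gap MA phi i by exact: weyr_perturb AB.
have rA : prank MA = nrank A0 A1 by exact: prank_trM.
have rB : prank MB = nrank B0 B1 by exact: prank_trM.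
have rAB := prank_col_perturb AB.
have r_q : (prank (col_mx MA phi) <= q)%N by exact: rank_leq_col.
have escA := @prank_col_escapes _ _ _ MA phi.
have escB := @prank_col_escapes _ _ _ MB phi.
have nescA := @prank_col_not_escapes _ _ _ MA phi.
have nescB := @prank_col_not_escapes _ _ _ MB phi.
have gA i := @gap_not_escapes _ _ _ MA phi i.
have gB i := @gap_not_escapes _ _ _ MB phi i.
(* With equal dim Z_(i-1), Delta_i is the change of dim T_i, at most one in either direction. *)
have small i : (sdim (kerval MA i.-1) = sdim (kerval MB i.-1))%N ->
    (0 < i)%N -> -1 <= D i <= 1.
  move=> ker i0; rewrite /D !weyrE// -/MA -/MB -ker.
  by have := lead_perturb_bound i AB; have := lead_perturb_bound i BA; lia.
have same : same_col_min_indices A0 A1 B0 B1 -> forall i, (0 < i)%N -> -1 <= D i <= 1.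
  move=> [e [[bsA [kA eA]] [bsB [kB eB]]]] i i0; apply: small => //.
  rewrite (sdim_kerval_kcf lam _ kA) (sdim_kerval_kcf lam _ kB).
  by rewrite -(permP eA) -(permP eB).
(* Each pencil has the rank of the stacked matrix, lowered by one exactly when it escapes. As the
   stacked rank is common, the four cases decide how the normal ranks compare. *)
have [eA|neA] := pselect (escapes MA phi); have [eB|neB] := pselect (escapes MB phi).
- have {}escA := escA eA; have {}escB := escB eB.
  have [a [a0 a1 a2 _]] := gap_escapes phi2 eA.
  have [b [b0 b1 b2 _]] := gap_escapes phi2 eB.
  have {}gA i : (i <= a)%N /\ 0 <= gap MA phi i <= 1 \/ (a < i)%N /\ - a%:Z <= gap MA phi i <= 0.
    by have [ia|ai] := leqP i a; [left; split=> //; exact: a1 | right; split=> //; exact: a2].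
  have {}gB i : (i <= b)%N /\ 0 <= gap MB phi i <= 1 \/ (b < i)%N /\ - b%:Z <= gap MB phi i <= 0.
    by have [ia|ai] := leqP i b; [left; split=> //; exact: b1 | right; split=> //; exact: b2].
  (* Both ranks are below [q], so neither pencil is regular. *)
  split; [by move=> [_ ra]; lia | by move=> [_ ra]; lia | by move=> _ [_ rb]; lia |].
  move=> _ _; split; [by move=> _; exact: same | | by move=> h; lia | by move=> h; lia].
  move=> _ _; have [ab|ba|ab] := ltngtP a b.
  + exists a, b; split; first by rewrite a0.
    by split=> [i|]; [|split=> i]; move=> h; have := gA i; have := gB i; rewrite DE; lia.
  + exists b, a; split; first by rewrite b0.
    by split=> [i|]; [|split=> i]; move=> h; have := gA i; have := gB i; rewrite DE; lia.
  (* For equal thresholds both gaps lie between [- a] and [0] beyond [a], so any larger integer can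
     be the second threshold. *)
  + exists a, a.+1; split; first by rewrite a0 ltnS leqnn.
    by split=> [i|]; [|split=> i]; move=> h; have := gA i; have := gB i; rewrite DE; lia.
- have {}escA := escA eA; have {}nescB := nescB neB.
  have [a [a0 a1 a2 a3]] := gap_escapes phi2 eA.
  have {}gB i := gB i neB.
  split; [by move=> [_ ra]; lia | by move=> [_ ra]; lia | |].
    move=> _ [_ rb].
    (* Regularity of the perturbed pencil gives the stacked matrix rank [q]; injectivity then keeps
       the gap of [MA] at least [-1], whence the bound [2]. *)
    have inj (x : 'cV_q) : col_mx MA phi *m x = 0 -> x = 0 by apply: prank_full_inj; rewrite ?rAB; lia.
    exists a; split=> //; split=> i h; have := gB i; rewrite DE; try by lia.
      by have := a1 i; lia.
    by have := a2 i; have := a3 inj i; lia.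
  move=> _ _; split; [by move=> _; exact: same | by move=> h; lia | | by move=> h; lia].
  move=> _; exists a; split=> //; split=> i h; have := gB i; rewrite DE; try by lia.
    by have := a1 i; lia.
  by have := a2 i; lia.
- have {}escB := escB eB; have {}nescA := nescA neA.
  have [a [a0 a1 a2 a3]] := gap_escapes phi2 eB.
  have {}gA i := gA i neA.
  split; [by move=> _ [_ rb]; lia | | by move=> _ [_ rb]; lia |].
    move=> [_ ra] _.
    have inj (x : 'cV_q) : col_mx MB phi *m x = 0 -> x = 0 by apply: prank_full_inj; rewrite ?rAB; lia.
    exists a; split=> //; split=> i h; have := gA i; rewrite DE; try by lia.
      by have := a1 i; lia.
    by have := a2 i; have := a3 inj i; lia.
  move=> _ _; split; [by move=> _; exact: same | by move=> h; lia | by move=> h; lia |].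
  move=> _; exists a; split=> //; split=> i h; have := gA i; rewrite DE; try by lia.
    by have := a1 i; lia.
  by have := a2 i; lia.
have {}nescA := nescA neA; have {}nescB := nescB neB.
have bound i : (0 < i)%N -> -1 <= D i <= 1.
  by move=> i0; have := gA i neA; have := gB i neB; rewrite DE//; lia.
split.
- by move=> _ _; exact: bound.
(* The ranks agree here, so the pencils are regular together or singular together. *)
- by move=> [pq ra] []; split=> //; lia.
- by move=> nrA [pq rb]; case: nrA; split=> //; lia.
move=> _ _; split; [by move=> _ _; exact: bound | | by move=> h; lia | by move=> h; lia].
(* The bound holds for every [i], so any two thresholds will do. *)
move=> _ _; exists 1%N, 2; split=> //.
by split=> [i h|]; [|split=> i h]; have := bound i; lia.
Qed.
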